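(* The following pairs $(G,H)$ have property (F) (that is, for any subset $S\subseteq H$ and any element $g\in G$ such that $gSg^{-1}\subseteq H$, there is an element $w\in N_G(H)$ such that $gsg^{-1}=wsw^{-1}$ for every $s\in S$): (i) $G=\mathrm{Aut}\,\mathbf A^n$ and $H$ is an $n$-dimensional torus in $\mathrm{Aut}\,\mathbf A^n$; (ii) $G=\mathrm{Aut}^*\mathbf A^n$ and $H$ is an $(n-1)$-dimensional torus in $\mathrm{Aut}^*\mathbf A^n$.
   Context: $k$ is an algebraically closed field of characteristic $0$; $\mathbf A^n$ is affine space over $k$ with standard coordinate functions $x_1,\ldots,x_n$. $\mathrm{Aut}\,\mathbf A^n$ is the group of polynomial automorphisms of $\mathbf A^n$, an element $g$ being written $(g_1,\ldots,g_n)$ with $g_i=g^*(x_i)$. $\mathrm{Jac}(g)=\det(\partial g_i/\partial x_j)\in k\setminus\{0\}$, and $\mathrm{Aut}^*\mathbf A^n=\{g\in\mathrm{Aut}\,\mathbf A^n\mid \mathrm{Jac}(g)=1\}$. A subgroup of $\mathrm{Aut}\,\mathbf A^n$ is called algebraic if it is the image of an algebraic group $G$ under a homomorphism $G\to\mathrm{Aut}\,\mathbf A^n$ for which the action map $G\times\mathbf A^n\to\mathbf A^n$ is a morphism; a torus in $\mathrm{Aut}\,\mathbf A^n$ (or in $\mathrm{Aut}^*\mathbf A^n$) is an algebraic subgroup (contained in $\mathrm{Aut}^*\mathbf A^n$, respectively) which is an algebraic torus. $N_G(H)$ denotes the normalizer of $H$ in $G$. *)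

(* Defs.v *)
From HB Require Import structures.
From mathcomp Require Import all_boot all_order all_algebra.
From mathcomp Require Import freeg mpoly.

Set Implicit Arguments.
Unset Strict Implicit.
Unset Printing Implicit Defensive.

Import GRing.Theory.
Local Open Scope ring_scope.

Section PropertyF.
Variable A : groupType.
Implicit Types (G H S : A -> Prop) (g s w : A).

(* N_G(H): the w in G such that w H w^-1 = H (equality of sets). *)
Definition normalizer G H : A -> Prop :=
  fun w => G w /\ forall h, H (w * h * w^-1)%g <-> H h.

Definition property_F G H : Prop :=
  forall S g, (forall s, S s -> H s) -> G g ->
    (forall s, S s -> H (g * s * g^-1)%g) ->
  exists2 w, normalizer G H w
           & forall s, S s -> (g * s * g^-1)%g = (w * s * w^-1)%g.

End PropertyF.

Section PolyMap.
Variables (R : comNzRingType) (n : nat).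

(* (p_1, ..., p_n) stands for the map x |-> (p_1(x), ..., p_n(x)), and
   polymap_comp p q for the map p o q : its i-th entry is p_i(q_1, ..., q_n). *)
Definition polymap := n.-tuple {mpoly R[n]}.

Definition polymap_id : polymap := [tuple 'X_i | i < n].

Definition polymap_comp (p q : polymap) : polymap :=
  [tuple tnth p i \mPo q | i < n].

Lemma polymap_comp1p : left_id polymap_id polymap_comp.
Proof.
move=> p; apply: eq_from_tnth => i.
by rewrite !tnth_mktuple comp_mpolyXU -tnth_nth.
Qed.

Lemma polymap_compp1 : right_id polymap_id polymap_comp.
Proof.
by move=> p; apply: eq_from_tnth => i; rewrite tnth_mktuple comp_mpoly_id.
Qed.

Lemma polymap_compA : associative polymap_comp.
Proof.
move=> p q r; apply: eq_from_tnth => i; rewrite !tnth_mktuple.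
rewrite [tnth p i \mPo q]comp_mpolyE raddf_sum comp_mpolyE /=.
apply: eq_bigr => m _; rewrite comp_mpolyZ rmorph_prod /=; congr (_ *: _).
by apply: eq_bigr => j _; rewrite tnth_mktuple rmorphXn.
Qed.

(* An automorphism is packed with its polynomial inverse, which is unique
   (polyaut_map_inj): invertibility is thereby a boolean condition, and polyaut
   inherits the choiceType structure that groupType requires. *)
Definition mutual_inverse (gh : polymap * polymap) : bool :=
  (polymap_comp gh.1 gh.2 == polymap_id) &&
  (polymap_comp gh.2 gh.1 == polymap_id).

Record polyaut := MkPolyaut { polyaut_pair : polymap * polymap; _ : mutual_inverse polyaut_pair }.

HB.instance Definition _ := [isSub for polyaut_pair].
HB.instance Definition _ := [Choice of polyaut by <:].

Definition polyaut_map (g : polyaut) : polymap := (polyaut_pair g).1.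

Lemma polyaut_map_inj : injective polyaut_map.
Proof.
case=> [[g h] gh] [[g' h'] gh'] /= eg; apply: val_inj => /=.
rewrite /polyaut_map /= in eg; move: gh gh'; rewrite -{}eg /mutual_inverse /=.
case/andP=> _ /eqP hg /andP[/eqP gh' _]; congr (_, _).
by rewrite -[h]polymap_compp1 -gh' polymap_compA hg polymap_comp1p.
Qed.

Fact polyaut_one_subproof : mutual_inverse (polymap_id, polymap_id).
Proof. by rewrite /mutual_inverse /= polymap_comp1p eqxx. Qed.

Fact polyaut_mul_subproof (g h : polyaut) :
  mutual_inverse (polymap_comp (polyaut_pair g).1 (polyaut_pair h).1,
                  polymap_comp (polyaut_pair h).2 (polyaut_pair g).2).
Proof.
case: g h => [[g g'] gP] [[h h'] hP] /=; move: gP hP; rewrite /mutual_inverse /=.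
case/andP=> /eqP gg' /eqP g'g /andP[/eqP hh' /eqP h'h].
rewrite polymap_compA -(polymap_compA g) hh' polymap_compp1 gg' eqxx /=.
by rewrite polymap_compA -(polymap_compA h') g'g polymap_compp1 h'h.
Qed.

Fact polyaut_inv_subproof (g : polyaut) :
  mutual_inverse ((polyaut_pair g).2, (polyaut_pair g).1).
Proof. by case: g => gh /=; rewrite /mutual_inverse /= andbC. Qed.

Definition polyaut_one : polyaut := MkPolyaut polyaut_one_subproof.
Definition polyaut_mul (g h : polyaut) : polyaut := MkPolyaut (polyaut_mul_subproof g h).
Definition polyaut_inv (g : polyaut) : polyaut := MkPolyaut (polyaut_inv_subproof g).

Lemma polyaut_mulA : associative polyaut_mul.
Proof. by move=> f g h; apply: polyaut_map_inj; exact: polymap_compA. Qed.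

Lemma polyaut_mul1 : left_id polyaut_one polyaut_mul.
Proof. by move=> g; apply: polyaut_map_inj; exact: polymap_comp1p. Qed.

Lemma polyaut_mulr1 : right_id polyaut_one polyaut_mul.
Proof. by move=> g; apply: polyaut_map_inj; exact: polymap_compp1. Qed.

Lemma polyaut_mulV : left_inverse polyaut_one polyaut_inv polyaut_mul.
Proof. by move=> g; apply: polyaut_map_inj; case/andP: (valP g) => _ /eqP. Qed.

Lemma polyaut_mulrV : right_inverse polyaut_one polyaut_inv polyaut_mul.
Proof. by move=> g; apply: polyaut_map_inj; case/andP: (valP g) => /eqP. Qed.

HB.instance Definition _ :=
  isGroup.Build polyaut polyaut_mulA polyaut_mul1 polyaut_mulr1 polyaut_mulV polyaut_mulrV.

Definition polyaut_act (g : polyaut) (x : 'rV[R]_n) : 'rV[R]_n :=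
  \row_i (tnth (polyaut_map g) i).@[x 0].

Lemma polyaut_actM (g h : polyaut) x : polyaut_act (g * h)%g x = polyaut_act g (polyaut_act h x).
Proof.
apply/rowP => i; rewrite !mxE /= tnth_mktuple comp_mpoly_meval.
by apply: meval_eq => j; rewrite mxE.
Qed.

Definition jac (g : polyaut) : {mpoly R[n]} :=
  \det (\matrix_(i < n, j < n) (tnth (polyaut_map g) i)^`M(j)).

Definition Aut_full : polyaut -> Prop := fun _ => True.
Definition Aut_star : polyaut -> Prop := fun g => jac g = 1.

End PolyMap.

Section Torus.
Variable k : fieldType.

Record Gm := MkGm { Gm_val : k; _ : Gm_val != 0 }.

HB.instance Definition _ := [isSub for Gm_val].
HB.instance Definition _ := [Choice of Gm by <:].

Fact Gm_mul_subproof (s t : Gm) : Gm_val s * Gm_val t != 0.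
Proof. by case: s t => s s0 [t t0] /=; rewrite mulf_neq0. Qed.
Fact Gm_inv_subproof (t : Gm) : (Gm_val t)^-1 != 0.
Proof. by case: t => t t0 /=; rewrite invr_eq0. Qed.

Definition Gm_one : Gm := MkGm (oner_neq0 k).
Definition Gm_mul (s t : Gm) : Gm := MkGm (Gm_mul_subproof s t).
Definition Gm_inv (t : Gm) : Gm := MkGm (Gm_inv_subproof t).

Lemma Gm_mulA : associative Gm_mul.
Proof. by move=> s t u; apply: val_inj; exact: mulrA. Qed.
Lemma Gm_mul1 : left_id Gm_one Gm_mul.
Proof. by move=> t; apply: val_inj; exact: mul1r. Qed.
Lemma Gm_mulr1 : right_id Gm_one Gm_mul.
Proof. by move=> t; apply: val_inj; exact: mulr1. Qed.
Lemma Gm_mulV : left_inverse Gm_one Gm_inv Gm_mul.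
Proof. by case=> t t0; apply: val_inj; exact: mulVf. Qed.
Lemma Gm_mulrV : right_inverse Gm_one Gm_inv Gm_mul.
Proof. by case=> t t0; apply: val_inj; exact: mulfV. Qed.

HB.instance Definition _ :=
  isGroup.Build Gm Gm_mulA Gm_mul1 Gm_mulr1 Gm_mulV Gm_mulrV.

(* The group (G_m)^d, with the pointwise group structure of {ffun _ -> _}. *)
Definition torus (d : nat) := {ffun 'I_d -> Gm}.
HB.instance Definition _ d := Group.on (torus d).

(* The closed embedding t |-> (t, t^-1) of (G_m)^d into A^(2d). *)
Definition torus_coord d (t : torus d) : 'rV[k]_(d + d) :=
  row_mx (\row_i Gm_val (t i)) (\row_i Gm_val (t^-1%g i)).

(* (t, x) |-> phi(t)(x) is a morphism (G_m)^d x A^n -> A^n. Regular functions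
   on (G_m)^d x A^n, i.e. the elements of k[t_i, t_i^-1, x_j], are the
   restrictions of polynomials along the closed embedding of (G_m)^d x A^n
   into A^(2d + n). *)
Definition morphic_action d n (phi : torus d -> polyaut k n) : Prop :=
  exists F : 'I_n -> {mpoly k[d + d + n]},
    forall (t : torus d) (x : 'rV[k]_n),
      polyaut_act (phi t) x = \row_i (F i).@[row_mx (torus_coord t) x 0].

(* H is an algebraic subgroup of Aut A^n that is a d-dimensional algebraic
   torus: an algebraic group isomorphic to (G_m)^d acts faithfully and
   morphically on A^n with image H. *)
Definition is_torus d n (H : polyaut k n -> Prop) : Prop :=
  exists phi : {multiplicative torus d -> polyaut k n},
    [/\ morphic_action phi, injective phi
      & forall g, H g <-> exists t, phi t = g].

Definition is_torus_star d n (H : polyaut k n -> Prop) : Prop :=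
  is_torus d H /\ forall g, H g -> Aut_star g.

End Torus.

(* Main.v *)
Require Import Defs.
From mathcomp Require Import all_boot all_order all_algebra perm.
From mathcomp Require Import freeg mpoly.
From mathcomp Require Import ring.
From Stdlib Require Import Classical ClassicalEpsilon.

(* The torus H is diagonal in suitable coordinates of A^n: it is the group of all
   diagonal automorphisms, respectively of those with determinant 1. If g
   conjugates a family of diagonal automorphisms a into diagonal automorphisms b,
   the derivative of g at the origin intertwines a and b, and a nonzero term of its
   determinant is a permutation that already carries all the a's to the b's.

   Linearisation, n-dimensional case: weight spaces of k[x] are lines, units are
   constants, so the weight vectors of nonzero weight span the ideal of a fixed
   point p. Weight vectors y_1, ..., y_n with jacobian nonzero at p have constant
   jacobian, and d/dy_i are derivations of k[x] lowering weights; this forces every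
   weight vector to be a monomial in the y_i.

   Linearisation, (n-1)-dimensional case: the weight-zero part E of the Euler field
   has divergence n, and together with the vector fields D_i of the torus it has a
   determinant u which is invariant and satisfies E u = n u. This makes E
   diagonalisable on the invariants, which form a polynomial ring k[z] with z an
   eigenvector, and every weight space is a free k[z]-module of rank one. After
   subtracting from E a combination of the D_i with coefficients in k[z], it becomes
   diagonalisable on k[x], and the n commuting fields D_1, ..., D_(n-1), E are
   handled as in the n-dimensional case. *)

Set Implicit Arguments.
Unset Strict Implicit.
Unset Printing Implicit Defensive.

Import GRing.Theory.
Local Open Scope ring_scope.

(** * Derivations and jacobians *)

Section Induction.
Variables (k : comNzRingType) (n : nat).

(** Jacobians of tuples of weight vectors do the work of tangent spaces. At least one such tuple has
    nonzero jacobian, because the jacobian 1 of the standard coordinates expands multilinearly into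
    jacobians of weight vectors. The obstacle in codimension one is that E need not be
    diagonalisable on k[x]: on the generator of the weight space of weight c it acts as
    multiplication by some polynomial a_c(z). Modulo constants a_c is additive in c, so one
    combination of the D_i over k[z] removes the nonconstant parts for all weights at once. The
    weight-zero part is taken so that E commutes with the torus; its divergence n, nonzero in
    characteristic 0, is the eigenvalue that makes u nonconstant. The condition Jac = 1 enters
    through weights: the weight of a jacobian is then the sum of the weights of its entries.
    Algebraic closedness enters through roots, which show that the linearised torus fills the whole
    diagonal group, so that a permutation of the coordinates normalises it. *)

Lemma mpoly_ring_ind (Q : {mpoly k[n]} -> Prop) :
  (forall c, Q c%:MP) -> (forall i, Q 'X_i) ->
  (forall f g, Q f -> Q g -> Q (f + g)) ->
  (forall f g, Q f -> Q g -> Q (f * g)) -> forall f, Q f.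
Proof.
move=> QC QX QD QM; elim/mpolyind => [|c m f _ _ Qf]; first exact: (QC 0).
apply: (QD) => //; rewrite -mul_mpolyC; apply: (QM) => //.
rewrite mpolyXE_id; apply: (big_ind Q (QC 1) QM) => i _.
by elim: (m i) => [|j IH]; rewrite ?expr0 ?exprS; [exact: (QC 1) | exact: QM].
Qed.

Lemma mderivXU (i j : 'I_n) : ('X_i : {mpoly k[n]})^`M(j) = (i == j)%:R.
Proof.
rewrite mderivX mnmE; case: eqP => [->|_]; last by rewrite scale0r.
rewrite scale1r (_ : (_ - _)%MM = 0%MM) ?mpolyX0 //.
by apply/mnmP => l; rewrite mnmBE subnn mnmE.
Qed.

End Induction.

Section Chain.
Variables (k : comNzRingType) (n : nat).

Lemma mderiv_comp (m : nat) (f : {mpoly k[m]}) (q : m.-tuple {mpoly k[n]}) j :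
  (f \mPo q)^`M(j) = \sum_i (f^`M(i) \mPo q) * (tnth q i)^`M(j).
Proof.
elim/mpolyind: f => [|c e f _ _ IH].
  by rewrite comp_mpoly0 mderiv0 big1 // => i _; rewrite mderiv0 comp_mpoly0 mul0r.
rewrite comp_mpolyD comp_mpolyZ mderivD mderivZ IH.
under [RHS]eq_bigr do rewrite mderivD mderivZ comp_mpolyD comp_mpolyZ mulrDl.
rewrite big_split /=; congr (_ + _).
have Q : ('X_[e] \mPo q)^`M(j) = \sum_i (('X_[e])^`M(i) \mPo q) * (tnth q i)^`M(j).
  rewrite mpolyXE_id.
  pose Q (f : {mpoly k[m]}) :=
    (f \mPo q)^`M(j) = \sum_i (f^`M(i) \mPo q) * (tnth q i)^`M(j).
  have QM f1 f2 : Q f1 -> Q f2 -> Q (f1 * f2).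
    rewrite /Q => Q1 Q2; rewrite rmorphM /= mderivM Q1 Q2.
    rewrite mulr_suml mulr_sumr -big_split /=; apply: eq_bigr => i _.
    by rewrite mderivM comp_mpolyD !rmorphM /=; ring.
  have Q1 : Q 1.
    by rewrite /Q comp_mpoly1 big1 ?mderivC // => i _; rewrite ?mderivC comp_mpoly0 mul0r.
  have QX i : Q 'X_i.
    rewrite /Q comp_mpolyXU -tnth_nth (bigD1 i) //= big1 => [|l li].
      by rewrite mderivXU eqxx comp_mpoly1 mul1r addr0.
    by rewrite mderivXU eq_sym (negbTE li) comp_mpoly0 mul0r.
  apply: (big_ind Q Q1 QM) => i _.
  elim: (e i) => [|l IHl]; first by rewrite expr0; exact: Q1.
  by rewrite exprS; apply: QM; [exact: QX | exact: IHl].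
by rewrite Q scaler_sumr; apply: eq_bigr => i _; rewrite scalerAl.
Qed.

End Chain.

Section Derivations.
Variables (k : comNzRingType) (n : nat).
Local Notation P := {mpoly k[n]}.

Definition derivation (D : P -> P) : Prop :=
  linear D /\ forall f g, D (f * g) = D f * g + f * D g.

Definition divergence (D : P -> P) : P := \sum_j (D 'X_j)^`M(j).

Section Theory.
Variable D : P -> P.
Hypothesis derD : derivation D.

Lemma der_linear : linear D. Proof. by case: derD. Qed.
Lemma derM f g : D (f * g) = D f * g + f * D g. Proof. by case: derD. Qed.
Lemma der_add f g : D (f + g) = D f + D g.
Proof. by rewrite -{1}[f]scale1r der_linear scale1r. Qed.
Lemma der0 : D 0 = 0.
Proof. by apply: (@addrI _ (D 0)); rewrite -der_add !addr0. Qed.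
Lemma derZ c f : D (c *: f) = c *: D f.
Proof. by rewrite -{1}[_ *: f]addr0 der_linear der0 addr0. Qed.
Lemma derN f : D (- f) = - D f.
Proof. by rewrite -!scaleN1r derZ. Qed.
Lemma derB f g : D (f - g) = D f - D g.
Proof. by rewrite der_add derN. Qed.
Lemma der_sum I (s : seq I) (Q : pred I) F :
  D (\sum_(i <- s | Q i) F i) = \sum_(i <- s | Q i) D (F i).
Proof. exact: (big_morph _ der_add der0). Qed.
Lemma der1 : D 1 = 0.
Proof.
have := derM 1 1; rewrite !mulr1 mul1r -{1}[D 1]addr0 => /addrI.
by move/esym.
Qed.
Lemma derC c : D c%:MP = 0.
Proof. by rewrite -[c%:MP]mulr1 mul_mpolyC derZ der1 scaler0. Qed.

Lemma der_expand f : D f = \sum_j D 'X_j * f^`M(j).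
Proof.
elim/mpoly_ring_ind: f => [c|i|f g Df Dg|f g Df Dg].
- by rewrite derC big1 // => j _; rewrite mderivC mulr0.
- rewrite (bigD1 i) //= mderivXU eqxx mulr1 big1 ?addr0 // => j ji.
  by rewrite mderivXU eq_sym (negbTE ji) mulr0.
- rewrite der_add Df Dg -big_split; apply: eq_bigr => j _.
  by rewrite mderivD mulrDr.
rewrite derM Df Dg mulr_suml mulr_sumr -big_split; apply: eq_bigr => j _ /=.
by rewrite mderivM; ring.
Qed.

Lemma derXn f m : D (f ^+ m) = m%:R * f ^+ m.-1 * D f.
Proof.
elim: m => [|m IH]; first by rewrite der1 !mul0r.
rewrite exprS derM IH -natr1; case: m {IH} => [|m] /=; first by rewrite !expr0; ring.
by rewrite exprS; ring.
Qed.

Lemma der_horner (q : {poly k}) f :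
  D (map_poly (@mpolyC n k) q).[f] = (map_poly (@mpolyC n k) q^`()).[f] * D f.
Proof.
elim/poly_ind: q => [|q c IH].
  by rewrite deriv0 !rmorph0 !horner0 der0 mul0r.
rewrite derivD derivM derivX derivC addr0 mulr1.
rewrite !(rmorphD, rmorphM) /= !map_polyX map_polyC.
by rewrite !hornerE der_add derM derC IH; ring.
Qed.

Lemma der_det m (M : 'M[P]_m) :
  D (\det M) = \sum_i \det (\matrix_(a, b) if a == i then D (M a b) else M a b).
Proof.
rewrite /determinant der_sum exchange_big; apply: eq_bigr => s _ /=.
have derProd (I : eqType) (r : seq I) (F : I -> P) : uniq r ->
    D (\prod_(i <- r) F i) =
    \sum_(i <- r) \prod_(j <- r) if j == i then D (F j) else F j.
  elim: r => [|i r IH] /=; first by rewrite !big_nil der1.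
  case/andP => ir ur; rewrite !big_cons derM eqxx IH //; congr (_ * _ + _).
    apply: eq_big_seq => j jr.
    by case: eqP => // ji; rewrite -ji jr in ir.
  rewrite mulr_sumr; apply: eq_big_seq => j jr.
  by rewrite big_cons; case: eqP => // ij; rewrite ij jr in ir.
have D0 (b : bool) : D ((-1) ^+ b) = 0.
  by case: b; rewrite ?expr0 ?expr1 ?derN der1 ?oppr0.
rewrite derM D0 mul0r add0r.
rewrite derProd ?index_enum_uniq // mulr_sumr; apply: eq_bigr => i _.
by congr (_ * _); apply: eq_bigr => j _; rewrite mxE.
Qed.

End Theory.

Lemma derivation_comb m (a : 'I_m -> P) (D : 'I_m -> P -> P) :
  (forall i, derivation (D i)) -> derivation (fun f => \sum_i a i * D i f).
Proof.
move=> dD; split=> [c f g|f g].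
  rewrite scaler_sumr -big_split; apply: eq_bigr => i _ /=.
  by rewrite (der_linear (dD i)) mulrDr scalerAr.
rewrite mulr_suml mulr_sumr -big_split; apply: eq_bigr => i _ /=.
by rewrite (derM (dD i)); ring.
Qed.

Lemma derivation_sub (D1 D2 : P -> P) :
  derivation D1 -> derivation D2 -> derivation (fun f => D1 f - D2 f).
Proof.
move=> d1 d2; split=> [c f g|f g].
  by rewrite (der_linear d1) (der_linear d2) scalerBr; ring.
by rewrite (derM d1) (derM d2); ring.
Qed.

Lemma derivation_mderiv j : derivation (mderiv j).
Proof. by split=> [c f g|f g]; rewrite ?mderivM // mderivD mderivZ. Qed.

Lemma divergence_comb m (a : 'I_m -> P) (D : 'I_m -> P -> P) :
  (forall i, derivation (D i)) ->
  divergence (fun f => \sum_i a i * D i f) =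
  \sum_i (D i (a i) + a i * divergence (D i)).
Proof.
move=> dD; rewrite /divergence.
under eq_bigr do rewrite raddf_sum.
rewrite exchange_big; apply: eq_bigr => i _ /=.
rewrite (der_expand (dD i) (a i)) mulr_sumr -big_split; apply: eq_bigr => j _ /=.
by rewrite mderivM; ring.
Qed.

Lemma divergence_sub (D1 D2 : P -> P) :
  divergence (fun f => D1 f - D2 f) = divergence D1 - divergence D2.
Proof. by rewrite /divergence -sumrB; apply: eq_bigr => j _; rewrite mderivB. Qed.

Lemma det_replace_row m (M : 'M[P]_m) i (r : 'I_m -> 'I_m -> P) :
  \det (\matrix_(a, b) if a == i then r a b else M a b) =
  \sum_b r i b * cofactor M i b.
Proof.
rewrite (expand_det_row _ i); apply: eq_bigr => b _; rewrite mxE eqxx.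
rewrite /cofactor (_ : row' i (col' b _) = row' i (col' b M)) //.
by apply/matrixP => p q; rewrite !mxE eq_sym (negbTE (neq_lift _ _)).
Qed.

(** Cofactor expansion along the replaced rows gives the trace of [M *m A *m \adj M], and the trace
    is cyclic. This is Jacobi's formula for the derivative of a determinant. *)
Lemma sum_det_rows m (M A : 'M[P]_m) :
  \sum_i \det (\matrix_(a, b) if a == i then (M *m A) a b else M a b) =
  \tr A * \det M.
Proof.
under eq_bigr do rewrite det_replace_row.
transitivity (\tr (M *m A *m \adj M)).
  by rewrite /mxtrace; apply: eq_bigr => i _; rewrite [RHS]mxE; apply: eq_bigr => b _; rewrite [\adj _ _ _]mxE.
by rewrite -mulmxA mxtrace_mulC -mulmxA mul_adj_mx mul_mx_scalar mxtraceZ mulrC.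
Qed.

Definition jacmx (y : 'I_n -> P) := \matrix_(i, j) (y i)^`M(j).
Definition jacobian (y : 'I_n -> P) : P := \det (jacmx y).
(** The map [f |-> jacobian (subst_at y i f)] is the partial derivative d/dy_i cleared of its
    denominator [jacobian y]. *)
Definition subst_at (y : 'I_n -> P) i f := fun j => if j == i then f else y j.

Lemma subst_atE y i f : jacobian (subst_at y i f) = \sum_b f^`M(b) * cofactor (jacmx y) i b.
Proof.
rewrite -(det_replace_row _ _ (fun _ b => f^`M(b))); congr (\det _); apply/matrixP => a b; rewrite !mxE /subst_at.
by case: eqP.
Qed.

Lemma derivation_subst y i : derivation (fun f => jacobian (subst_at y i f)).
Proof.
split=> [c f g|f g]; rewrite !subst_atE.
  rewrite scaler_sumr -big_split; apply: eq_bigr => b _ /=.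
  by rewrite mderivD mderivZ mulrDl scalerAl.
rewrite mulr_suml mulr_sumr -big_split; apply: eq_bigr => b _ /=.
by rewrite mderivM; ring.
Qed.

Lemma eq_jacobian y y' : y =1 y' -> jacobian y = jacobian y'.
Proof. by move=> yy; congr (\det _); apply/matrixP => a b; rewrite !mxE yy. Qed.

Lemma jacobian_id : jacobian (fun i : 'I_n => 'X_i) = 1 :> P.
Proof.
by rewrite -(det1 _ n); congr (\det _); apply/matrixP => i j; rewrite !mxE mderivXU.
Qed.

Lemma subst_at_id y i : jacobian (subst_at y i (y i)) = jacobian y.
Proof. by apply: eq_jacobian => j; rewrite /subst_at; case: eqP => [->|]. Qed.

(** The jacobian is the coefficient of dy_1 ∧ ... ∧ dy_n with respect to dx_1 ∧ ... ∧ dx_n. The Lie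
    derivative along [D] acts on the first form factor by factor and multiplies the second by the
    divergence. *)
Lemma der_jacobian D y : derivation D ->
  D (jacobian y) =
  \sum_i jacobian (subst_at y i (D (y i))) - divergence D * jacobian y.
Proof.
move=> dD; rewrite /jacobian (der_det dD).
pose A := \matrix_(l, j) (D 'X_l)^`M(j) : 'M[P]_n.
have -> : divergence D * \det (jacmx y) = \tr A * \det (jacmx y).
  by congr (_ * _); apply: eq_bigr => j _; rewrite mxE.
rewrite -sum_det_rows -sumrB; apply: eq_bigr => i _.
rewrite -[RHS]/(jacobian _ - _) subst_atE !det_replace_row -sumrB.
apply: eq_bigr => b _; rewrite -mulrBl; congr (_ * _).
rewrite !mxE (der_expand dD (y i)) raddf_sum (der_expand dD) -sumrB /=.
apply: eq_bigr => j _; rewrite !mxE mderivM mderiv_comm; ring.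
Qed.

(** The determinant is the standard volume form evaluated on the fields [X i]. The Lie derivative
    along [D] kills fields commuting with [D] and multiplies the form by the divergence. *)
Lemma der_det_commuting (X : 'I_n -> P -> P) D : derivation D ->
  (forall i, derivation (X i)) -> (forall i f, D (X i f) = X i (D f)) ->
  D (\det (\matrix_(i, j) X i 'X_j)) = divergence D * \det (\matrix_(i, j) X i 'X_j).
Proof.
move=> dD dX cD; rewrite (der_det dD).
pose A := \matrix_(l, j) (D 'X_j)^`M(l) : 'M[P]_n.
have -> : divergence D = \tr A by apply: eq_bigr => j _; rewrite mxE.
rewrite -sum_det_rows; apply: eq_bigr => i _; congr (\det _).
apply/matrixP => a b; rewrite !mxE; case: eqP => // _.
by rewrite cD (der_expand (dX a)); apply: eq_bigr => j _; rewrite !mxE.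
Qed.

(* Cramer's rule. *)
Lemma gradient_cramer y f j :
  jacobian y * f^`M(j) = \sum_i (y i)^`M(j) * jacobian (subst_at y i f).
Proof.
under eq_bigr do rewrite subst_atE mulr_sumr.
rewrite exchange_big /=.
transitivity (\sum_b f^`M(b) * (\adj (jacmx y) *m jacmx y) b j).
  rewrite mul_adj_mx (bigD1 j) //= big1 => [|b bj]; rewrite !mxE.
    by rewrite eqxx mulr1n addr0 mulrC.
  by rewrite (negbTE bj) mulr0n mulr0.
apply: eq_bigr => b _; rewrite mxE mulr_sumr; apply: eq_bigr => i _.
by rewrite !mxE; ring.
Qed.

Lemma der_subst y f D : derivation D ->
  jacobian y * D f = \sum_i D (y i) * jacobian (subst_at y i f).
Proof.
move=> dD; rewrite (der_expand dD f) mulr_sumr.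
under eq_bigr do rewrite mulrCA gradient_cramer mulr_sumr.
rewrite exchange_big /=; apply: eq_bigr => i _.
rewrite (der_expand dD (y i)) mulr_suml; apply: eq_bigr => j _; ring.
Qed.

(** Multilinearity of the jacobian. Applied to the coordinates, whose jacobian is 1, it produces
    tuples of weight vectors with nonzero jacobian. *)
Lemma jacobian_span (G Psi : P -> Prop) :
  (forall f, exists s : seq P, (forall g, g \in s -> G g) /\ f = \sum_(g <- s) g) ->
  Psi 0 -> (forall f g, Psi f -> Psi g -> Psi (f + g)) ->
  (forall y : 'I_n -> P, (forall i, G (y i)) -> Psi (jacobian y)) ->
  forall y, Psi (jacobian y).
Proof.
move=> dec Psi0 PsiD PsiG.
(* [m] bounds the entries not yet known to lie in [G]; each induction step expands one more
   entry. *)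
suff Q m : forall y : 'I_n -> P, (forall i : 'I_n, (m <= i)%N -> G (y i)) -> Psi (jacobian y).
  by move=> y; apply: (Q n) => i; rewrite leqNgt ltn_ord.
elim: m => [|m IH] y Gy; first by apply: PsiG => i; exact: Gy.
case: (ltnP m n) => [mn|nm]; last first.
  by apply: IH => i mi; move: (leq_trans nm mi); rewrite leqNgt ltn_ord.
pose i := Ordinal mn; rewrite -(subst_at_id y i).
have [s [Gs ->]] := dec (y i).
rewrite (der_sum (derivation_subst y i)) big_seq.
apply: (big_ind Psi) => // g gs; apply: IH => j mj; rewrite /subst_at.
case: eqP => [_|/eqP ji]; first exact: Gs.
by apply: Gy; rewrite ltn_neqAle mj andbT; apply: contraNneq ji => mj'; apply/eqP/val_inj.
Qed.

End Derivations.

(** * Polynomials over a field of characteristic zero *)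

Section CharZero.
Variables (k : fieldType) (n : nat).
Hypothesis char0 : [pchar k] =i pred0.
Local Notation P := {mpoly k[n]}.

Lemma natr_eq0 m : (m%:R == 0 :> k) = (m == 0)%N.
Proof. exact: (proj1 (pcharf0P k) char0). Qed.

Lemma natr_neq0 m : (0 < m)%N -> m%:R != 0 :> k.
Proof. by rewrite natr_eq0 lt0n. Qed.

Lemma natr_inj : injective (fun m : nat => m%:R : k).
Proof.
suff Q a b : (a <= b)%N -> a%:R = b%:R :> k -> a = b.
  by move=> a b ab; case: (leqP a b) => [/Q->|/ltnW/Q->].
move=> ab /eqP; rewrite eq_sym -subr_eq0 -natrB // natr_eq0 subn_eq0 => ba.
by apply/eqP; rewrite eqn_leq ab.
Qed.

Lemma intr_inj : injective (fun m : int => m%:~R : k).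
Proof.
have Q m : m%:~R = 0 :> k -> m = 0.
  case: m => m; first by rewrite -pmulrn => /eqP; rewrite natr_eq0 => /eqP->.
  by rewrite NegzE mulrNz -pmulrn => /eqP; rewrite oppr_eq0 natr_eq0.
by move=> a b ab; apply/eqP; rewrite -subr_eq0; apply/eqP/Q; rewrite rmorphB /= ab subrr.
Qed.

Lemma poly_vanish (q : {poly k}) : (forall t, q.[t] = 0) -> q = 0.
Proof.
move=> q0; apply/eqP; apply: contraT => nz.
have := @max_poly_roots _ q [seq i%:R | i <- iota 0 (size q)] nz.
rewrite size_map size_iota ltnn => -> //; last by rewrite (map_inj_uniq natr_inj) iota_uniq.
by apply/allP => t _; rewrite /root q0.
Qed.

Lemma gradient0 (f : P) : (forall j, f^`M(j) = 0) -> f = (f@_0)%:MP.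
Proof.
move=> df; apply/mpolyP => m; rewrite mcoeffC.
case: (eqVneq m 0%MM) => [->|m0]; first by rewrite mulr1.
rewrite mulr0; have [i mi] : exists i, (0 < m i)%N.
  apply/existsP; apply: contraNT m0; rewrite negb_exists => /forallP m0.
  by apply/eqP/mnmP => i; rewrite mnmE; move: (m0 i); rewrite -eqn0Ngt => /eqP.
have /(congr1 (mcoeff (m - U_(i))%MM)) := df i; rewrite mcoeff0 mcoeff_deriv.
rewrite submK; last by apply/mnm_lepP => l; rewrite mnmE; case: eqP => // <-.
move/eqP; rewrite -mulr_natr mulf_eq0 => /orP[/eqP //|].
by rewrite (negbTE (natr_neq0 _)).
Qed.

Lemma msize_mderiv (f : P) j N : (msize f <= N.+1)%N -> (msize f^`M(j) <= N)%N.
Proof.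
move=> fN; rewrite msizeE; apply/bigmax_leqP_seq => m; rewrite mcoeff_msupp mcoeff_deriv => nz _.
have : (m + U_(j))%MM \in msupp f by rewrite mcoeff_msupp; apply: contraNneq nz => ->; rewrite mul0rn.
by move/msize_mdeg_lt; rewrite mdegD mdeg1 addn1 => lt; rewrite -ltnS (leq_trans lt).
Qed.

Lemma mpoly_unit_const (f g : P) c : c != 0 -> f * g = c%:MP -> f = (f@_0)%:MP.
Proof.
move=> c0 fg; have fU : f \is a GRing.unit.
  by apply/unitrP; exists (c^-1 *: g); rewrite -scalerAl mulrC -scalerAr fg -mul_mpolyC -mpolyCM mulVf.
by case/andP: fU => /eqP.
Qed.

Section Point.
Variable p : 'I_n -> k.

(* f vanishes at p to order greater than m. *)
Fixpoint vanishing m (f : P) : Prop :=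
  f.@[p] = 0 /\ if m is m'.+1 then forall j, vanishing m' f^`M(j) else True.

Lemma vanishing0 m f : vanishing m f -> f.@[p] = 0.
Proof. by case: m => [|m] []. Qed.

Lemma vanishing_pred m f : vanishing m.+1 f -> vanishing m f.
Proof.
elim: m f => [|m IH] f [f0 df]; split=> //.
by move=> j; apply: IH; exact: df.
Qed.

Lemma vanishing_add m f g : vanishing m f -> vanishing m g -> vanishing m (f + g).
Proof.
elim: m f g => [|m IH] f g [f0 df] [g0 dg]; split=> //; rewrite ?mevalD ?f0 ?g0 ?addr0 //.
by move=> j; rewrite mderivD; apply: IH; [exact: df | exact: dg].
Qed.

Lemma vanishing_zero m : vanishing m 0.
Proof.
by elim: m => [|m IH]; split; rewrite ?meval0 // => j; rewrite mderiv0.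
Qed.

Lemma vanishing_mul m f g : vanishing m f -> vanishing m (g * f).
Proof.
elim: m f g => [|m IH] f g vf; split => //; rewrite ?mevalM ?(vanishing0 vf) ?mulr0 //.
move=> j; rewrite mderivM; apply: vanishing_add; apply: (IH).
  exact: vanishing_pred.
by case: vf => _ /(_ j).
Qed.

Lemma vanishing_sum m I (s : seq I) (F : I -> P) :
  (forall i, vanishing m (F i)) -> vanishing m (\sum_(i <- s) F i).
Proof.
move=> vF; apply: (big_ind (vanishing m)) => //.
  exact: vanishing_zero.
exact: vanishing_add.
Qed.

(** [g] is a unit in the local ring at [p]; the Leibniz rule and induction on the order do the work
    of localisation. *)
Lemma vanishing_mulI m f g : g.@[p] != 0 -> vanishing m (g * f) -> vanishing m f.
Proof.
move=> g0; elim: m f => [|m IH] f vgf.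
  split=> //; apply/eqP; move: (vanishing0 vgf) => /eqP.
  by rewrite mevalM mulf_eq0 (negbTE g0).
have vf : vanishing m f by apply: (IH); exact: vanishing_pred.
split; first exact: vanishing0 vf.
move=> j; apply: (IH); case: vgf => _ /(_ j); rewrite mderivM => vj.
have -> : g * f^`M(j) = - g^`M(j) * f + (g^`M(j) * f + g * f^`M(j)) by ring.
by apply: vanishing_add vj; exact: vanishing_mul.
Qed.

Lemma vanishing_all f : (forall m, vanishing m f) -> f = 0.
Proof.
suff Q N : forall f, (msize f <= N)%N -> (forall m, vanishing m f) -> f = 0 by exact: (Q (msize f)).
elim: N => [|N IH] {}f fN vf.
  by apply/eqP; rewrite -msize_poly_eq0 -leqn0.
have fc : f = (f@_0)%:MP.
  apply: gradient0 => j; apply: IH; first exact: msize_mderiv.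
  by move=> m; case: (vf m.+1) => _ /(_ j).
by move: (vanishing0 (vf 0%N)); rewrite fc mevalC => ->.
Qed.

End Point.

Lemma meval_eq0 (f : P) : (forall x, f.@[x] = 0) -> f = 0.
Proof.
move=> f0; apply: (@vanishing_all (fun _ => 0)) => m.
elim: m f f0 => [|m IH] f f0; split=> // j; apply: IH => x.
(* [L] restricts to the line through [x] in the j-th direction. [L f] has only zero values, hence is
   zero, and its derivative at 0 is the j-th partial derivative of [f] at [x]; so the hypothesis
   passes to derivatives. *)
pose L := mmap (@polyC k) (fun i => (x i)%:P + (i == j)%:R *: 'X).
have LE (g : P) t : (L g).[t] = g.@[fun i => x i + (i == j)%:R * t].
  elim/mpoly_ring_ind: g => [c|i|g h Lg Lh|g h Lg Lh].
  - by rewrite /L mmapC hornerC mevalC.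
  - by rewrite /L mmapX mmap1U mevalXU !hornerE.
  - by rewrite /L mmapD hornerD mevalD Lg Lh.
  by rewrite /L rmorphM /= hornerM mevalM Lg Lh.
have dL (g : P) : (L g)^`() = L g^`M(j).
  elim/mpoly_ring_ind: g => [c|i|g h Lg Lh|g h Lg Lh].
  - by rewrite /L mmapC derivC mderivC mmap0.
  - rewrite /L mmapX mmap1U mderivXU derivD derivC add0r derivZ derivX.
    by rewrite -[RHS]/(mmap _ _ (_%:R)) rmorph_nat scaler_nat.
  - by rewrite /L mmapD derivD mderivD mmapD Lg Lh.
  by rewrite /L mderivM mmapD !rmorphM /= derivM -!/(L _) Lg Lh.
have L0 : L f = 0 by apply: poly_vanish => t; rewrite LE f0.
move: (congr1 (fun q => q^`().[0]) L0); rewrite dL LE deriv0 horner0 => <-.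
by apply: meval_eq => i; rewrite mulr0 addr0.
Qed.

Lemma meval_ext (f g : P) : (forall x, f.@[x] = g.@[x]) -> f = g.
Proof.
move=> fg; apply/eqP; rewrite -subr_eq0; apply/eqP/meval_eq0 => x.
by rewrite mevalB fg subrr.
Qed.

Lemma exists_nonzero (f : P) : f != 0 -> exists x, f.@[x] != 0.
Proof.
move=> f0; apply: NNPP => nx; move/negP: f0; apply; apply/eqP/meval_eq0 => x.
by apply/eqP/negPn/negP => fx; apply: nx; exists x.
Qed.

(** The hypothesis says that f/g has zero gradient. With c its value at a point where [g] is
    nonzero, s = f - c g satisfies the same relation, which raises the vanishing order of s there
    indefinitely. *)
Lemma proportional (f g : P) : g != 0 ->
  (forall j, f * g^`M(j) = g * f^`M(j)) -> exists c, f = c *: g.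
Proof.
move=> /exists_nonzero[p gp] fg; exists (f.@[p] / g.@[p]); apply/eqP.
rewrite -subr_eq0; set s := f - _; apply/eqP.
have sg j : s * g^`M(j) = g * s^`M(j).
  by rewrite /s mderivB mderivZ mulrBl mulrBr fg -!mul_mpolyC; ring.
apply: (@vanishing_all p); elim=> [|m IH].
  by split=> //; rewrite /s mevalB mevalZ divfK ?subrr.
split=> [|j]; first exact: vanishing0 IH.
by apply: (vanishing_mulI gp); rewrite -sg mulrC; exact: vanishing_mul.
Qed.

End CharZero.

(** Division by increasing powers: [A] is invertible as a power series, and [Q] is the quotient B/A
    truncated at order [N]. *)
Lemma divide_power_series (R : comUnitRingType) N (A B : {poly R}) : A`_0 \is a GRing.unit ->
  exists Q r, B = A * Q + 'X^N * r /\ (size Q <= N)%N.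
Proof.
move=> A0; elim: N => [|N [Q [r [-> sQ]]]].
  by exists 0, B; rewrite mulr0 add0r expr0 mul1r size_poly0.
pose q := r`_0 / A`_0.
have : root (r - A * q%:P) 0.
  by rewrite /root hornerD hornerN hornerM hornerC !horner_coef0 /q mulrCA divrr // mulr1 subrr.
case/factor_theorem => r'; rewrite subr0 => Er.
exists (Q + 'X^N * q%:P), r'; split.
  have -> : r = r' * 'X + A * q%:P by rewrite -Er subrK.
  by rewrite exprS; ring.
rewrite (leq_trans (size_polyD _ _)) // geq_max (leq_trans sQ) //=.
by rewrite mulrC mul_polyC (leq_trans (size_scale_leq _ _)) // size_polyXn.
Qed.

(** * Divisibility from divisibility of powers *)

Section RootClosed.
Variables (k : fieldType) (n : nat).
Hypothesis char0 : [pchar k] =i pred0.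
Local Notation P := {mpoly k[n]}.

Lemma line_morphism (p : 'I_n -> k) : exists L : {rmorphism P -> {poly P}},
  (forall c, L c%:MP = c%:MP%:P) /\
  (forall i, L 'X_i = (p i)%:MP%:P + 'X * ('X_i - (p i)%:MP)%:P).
Proof.
pose v i : {poly P} := (p i)%:MP%:P + 'X * ('X_i - (p i)%:MP)%:P.
exists (mmap (polyC \o @mpolyC n k) v : {rmorphism P -> {poly P}}).
by split=> [c|i]; [exact: mmapC | rewrite /= mmapX mmap1U].
Qed.

(* The line through p and x is parametrised by p + t(x - p); along it the
   divisibility holds by unique factorisation in k[t], and since a(p) <> 0 the
   quotient is the truncation of a power series whose coefficients are
   polynomials in x. *)
Lemma dvd_of_dvd_pow m (a b c : P) : (0 < m)%N -> a != 0 -> b ^+ m = a ^+ m * c ->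
  exists q, b = a * q.
Proof.
move=> m0 /(exists_nonzero char0)[p ap] bac.
have [L [LC LX]] := line_morphism p.
have L1 (g : P) : (L g).[1] = g.
  elim/mpoly_ring_ind: g => [d|i|g h Lg Lh|g h Lg Lh].
  - by rewrite LC hornerC.
  - by rewrite LX hornerD hornerM hornerX !hornerC mul1r addrC subrK.
  - by rewrite rmorphD hornerD Lg Lh.
  by rewrite rmorphM hornerM Lg Lh.
have L0 (g : P) : (L g).[0] = (g.@[p])%:MP.
  elim/mpoly_ring_ind: g => [d|i|g h Lg Lh|g h Lg Lh].
  - by rewrite LC hornerC mevalC.
  - by rewrite LX mevalXU hornerD hornerM hornerX !hornerC mul0r addr0.
  - by rewrite rmorphD hornerD mevalD mpolyCD Lg Lh.
  by rewrite rmorphM hornerM mevalM mpolyCM Lg Lh.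
have aU : (L a)`_0 \is a GRing.unit.
  rewrite -horner_coef0 L0; apply/unitrP; exists ((a.@[p])^-1)%:MP.
  by rewrite -!mpolyCM mulVf // mulfV.
(* The order exceeds the degree in t of the true quotient on every line. Truncation therefore loses
   nothing and [r] vanishes; setting t = 1 then returns from the line to the polynomials
   themselves. *)
have [Q [r [bQ sQ]]] := divide_power_series (size (L b)) (L b) aU.
suff r0 : r = 0 by exists Q.[1]; rewrite -[b in LHS]L1 bQ r0 mulr0 addr0 hornerM L1.
apply/polyP => i; rewrite coef0; apply: (meval_eq0 char0) => x.
pose e : {rmorphism {poly P} -> {poly k}} := map_poly (meval x).
have eE q : e q = map_poly (meval x) q by [].
clearbody e.
have ea0 : (e (L a)).[0] != 0.
  by rewrite horner_coef0 eE coef_map /= -horner_coef0 L0 mevalC.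
have ea : e (L a) != 0 by apply: contraNneq ea0 => ->; rewrite horner0.
have ebac : e (L b) ^+ m = e (L a) ^+ m * e (L c).
  by rewrite -rmorphXn -rmorphXn bac rmorphM rmorphXn rmorphM rmorphXn.
have : e (L a) %| e (L b) by rewrite -(dvdp_pexp2r _ _ m0) ebac; exact: dvdp_mulIl.
case/dvdpP => C eC.
have sC : (size C <= size (L b))%N.
  have [C0|C0] := eqVneq C 0; first by rewrite C0 size_poly0.
  have := leq_trans _ (size_poly _ _ : size (map_poly (meval x) (L b)) <= _)%N; apply; rewrite -eE eC.
  by rewrite size_mul // -[X in (_ <= X)%N]subn1 -addnBA ?leq_addr // lt0n size_poly_eq0.
have eQ : e (L a) * (C - e Q) = 'X^(size (L b)) * e r.
  have eb : e (L b) = e (L a) * e Q + 'X^(size (L b)) * e r.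
    by rewrite {1}bQ rmorphD rmorphM rmorphM [e 'X^_]eE map_polyXn.
  by rewrite mulrBr [_ * C]mulrC -eC eb addrAC subrr add0r.
suff er : e r = 0 by rewrite -[LHS]coef_map -eE er coef0.
suff CQ : C - e Q = 0.
  move/eqP: eQ; rewrite CQ mulr0 eq_sym mulf_eq0 expf_eq0 polyX_eq0 andbF /=.
  by move/eqP->.
apply/eqP; apply: contraT => nz.
have : 'X^(size (L b)) %| C - e Q.
  rewrite -(@Gauss_dvdpr _ _ (e (L a))) ?eQ ?dvdp_mulr //.
  by apply: coprimep_expl; rewrite coprimep_sym -[X in coprimep _ X]subr0 -polyC0 coprimep_XsubC.
move/(dvdp_leq nz); rewrite size_polyXn ltnNge; apply: contraNT => _.
rewrite (leq_trans (size_polyD _ _)) // geq_max sC size_polyN.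
by rewrite eE (leq_trans (size_poly _ _)).
Qed.

End RootClosed.

(** * Direct sums of weight spaces and their projections *)

Section WeightSums.
Variables (k : fieldType) (P : lmodType k) (V : eqType).
Implicit Types (W : V -> P -> Prop) (Q : V -> Prop).

Definition weight_sum W Q (f : P) : Prop :=
  exists s : seq P, (forall g, g \in s -> exists2 x, Q x & W x g) /\ f = \sum_(g <- s) g.

Lemma weight_sum0 W Q : weight_sum W Q 0.
Proof. by exists [::]; rewrite big_nil. Qed.

Lemma weight_sum1 W Q x f : Q x -> W x f -> weight_sum W Q f.
Proof.
move=> Qx Wf; exists [:: f]; rewrite big_seq1; split=> // g.
by rewrite inE => /eqP ->; exists x.
Qed.

Lemma weight_sum_add W Q f g : weight_sum W Q f -> weight_sum W Q g -> weight_sum W Q (f + g).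
Proof.
move=> [s [sW ->]] [t [tW ->]]; exists (s ++ t); rewrite big_cat; split=> // h.
by rewrite mem_cat => /orP[/sW|/tW].
Qed.

Lemma weight_sum_sum W Q (s : seq P) (F : P -> P) :
  (forall g, g \in s -> weight_sum W Q (F g)) -> weight_sum W Q (\sum_(g <- s) F g).
Proof.
move=> QF; rewrite big_seq; apply: (big_ind (weight_sum W Q)) => //.
  exact: weight_sum0.
exact: weight_sum_add.
Qed.

Lemma weight_sum_map W Q Q' (h : P -> P) f :
  {morph h : a b / a + b} -> h 0 = 0 ->
  (forall x g, Q x -> W x g -> weight_sum W Q' (h g)) ->
  weight_sum W Q f -> weight_sum W Q' (h f).
Proof.
move=> hD h0 hW [s [sW ->]]; rewrite (big_morph h hD h0).
by apply: weight_sum_sum => g /sW[x Qx Wg]; exact: hW Qx Wg.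
Qed.

Lemma weight_sum_mono W Q Q' f :
  (forall x, Q x -> Q' x) -> weight_sum W Q f -> weight_sum W Q' f.
Proof.
by move=> QQ [s [sW ->]]; exists s; split=> // g /sW[x /QQ Qx Wx]; exists x.
Qed.

Lemma weight_sum_split W Q f : weight_sum W (fun=> True) f ->
  exists f1 f2, [/\ f = f1 + f2, weight_sum W Q f1 & weight_sum W (fun x => ~ Q x) f2].
Proof.
move=> [s [sW ->]]; elim: s sW => [|g s IH] sW.
  by exists 0, 0; rewrite big_nil addr0; split=> //; exact: weight_sum0.
have [h hs|f1 [f2 [E W1 W2]]] := IH; first by apply: sW; rewrite inE hs orbT.
have [|x _ Wg] := sW g; first by rewrite inE eqxx.
rewrite big_cons E; have [Qx|Qx] := classic (Q x).
  exists (g + f1), f2; rewrite addrA; split=> //.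
  by apply: weight_sum_add => //; exact: weight_sum1 Wg.
exists f1, (g + f2); rewrite addrCA; split=> //.
by apply: weight_sum_add => //; exact: weight_sum1 Wg.
Qed.

Definition weights_independent W :=
  forall x f, W x f -> weight_sum W (fun y => y <> x) f -> f = 0.

(** Applying [T a] minus the eigenvalue of the first summand removes that summand and multiplies [f]
    by a scalar, nonzero when [a] separates the two weights; induct on the number of summands. *)
Lemma eigen_independent (A : Type) (T : A -> P -> P) (ev : A -> V -> k) :
  (forall a, linear (T a)) -> (forall x y, x <> y -> exists a, ev a x <> ev a y) ->
  weights_independent (fun x f => forall a, T a f = ev a x *: f).
Proof.
move=> linT sep x f Wf [s [sW Ef]].
have T0 a : T a 0 = 0.
  have := linT a 1 0 0; rewrite !scale1r !addr0 -[X in X = _]addr0.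
  by move/addrI.
have TD a g h : T a (g + h) = T a g + T a h.
  by have := linT a 1 g h; rewrite !scale1r.
have TZ a c g : T a (c *: g) = c *: T a g by have := linT a c g 0; rewrite T0 !addr0.
have [m sm] : exists m, size s = m by exists (size s).
elim: m s f sm Wf sW Ef => [|m IH] [|g s] f //=; first by rewrite big_nil.
move=> [sm] Wf sW; rewrite big_cons => Ef.
have [|y yx Wg] := sW g; first by rewrite inE eqxx.
have [a eva] := sep _ _ yx.
pose c := ev a x - ev a y.
have c0 : c != 0 by rewrite subr_eq0; apply/eqP => e; apply: eva.
have WZ d z h : (forall b, T b h = ev b z *: h) ->
    forall b, T b (d *: h) = ev b z *: (d *: h).
  by move=> Wh b; rewrite TZ Wh !scalerA mulrC.
suff : c *: f = 0.
  by move/eqP; rewrite scaler_eq0 (negbTE c0) => /eqP.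
apply: (IH [seq T a h - ev a y *: h | h <- s]).
- by rewrite size_map.
- exact: WZ.
- move=> _ /mapP[h hs ->]; have [|z zx Wh] := sW h; first by rewrite inE hs orbT.
  by exists z => //; rewrite Wh -scalerBl; exact: WZ.
rewrite big_map sumrB -scaler_sumr -(big_morph _ (TD a) (T0 a)) /c scalerBl -Wf Ef TD Wg.
by rewrite scalerDr opprD addrACA subrr add0r.
Qed.

Section Projections.
Variable W : V -> P -> Prop.
Hypothesis W_lin : forall x c f g, W x f -> W x g -> W x (c *: f + g).
Hypothesis W0 : forall x, W x 0.
Hypothesis W_indep : weights_independent W.
Hypothesis W_total : forall f, weight_sum W (fun=> True) f.

Lemma weight_projection_exists x f :
  exists g, W x g /\ weight_sum W (fun y => y <> x) (f - g).
Proof.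
have [f1 [f2 [-> [s [sW E1]] W2]]] := weight_sum_split (fun y => y = x) (W_total f).
exists f1; rewrite addrC addKr; split=> //; rewrite E1 big_seq.
apply: (big_ind (W x)) => // [g h Wg Wh|g /sW[y -> //]].
by rewrite -[g]scale1r; exact: W_lin.
Qed.

Definition proj x f : P :=
  proj1_sig (constructive_indefinite_description _ (weight_projection_exists x f)).

Lemma projP x f : W x (proj x f) /\ weight_sum W (fun y => y <> x) (f - proj x f).
Proof. by rewrite /proj; case: constructive_indefinite_description. Qed.

Lemma proj_weight x f : W x (proj x f). Proof. by case: (projP x f). Qed.

Lemma weight_sum_sub Q f g : weight_sum W Q f -> weight_sum W Q g -> weight_sum W Q (f - g).
Proof.
move=> Wf Wg; apply: weight_sum_add => //.
apply: (@weight_sum_map W Q Q -%R) Wg; [exact: opprD | exact: oppr0 | ] => x h Qx Wh.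
apply: (weight_sum1 Qx); rewrite -[- h]addr0 -scaleN1r; exact: W_lin.
Qed.

Lemma proj_unique x f g : W x g -> weight_sum W (fun y => y <> x) (f - g) -> proj x f = g.
Proof.
move=> Wg Wfg; case: (projP x f) => Wp Wfp; apply/eqP; rewrite -subr_eq0; apply/eqP.
apply: (W_indep (x := x)).
  by rewrite addrC -scaleN1r; apply: W_lin.
have -> : proj x f - g = (f - g) - (f - proj x f).
  by rewrite opprB [RHS]addrC addrA subrK.
exact: weight_sum_sub.
Qed.

Lemma proj_id x f : W x f -> proj x f = f.
Proof. by move=> Wf; apply: proj_unique; rewrite ?subrr //; exact: weight_sum0. Qed.

Lemma proj_other x y f : y <> x -> W y f -> proj x f = 0.
Proof.
by move=> yx Wf; apply: proj_unique; rewrite ?subr0; [exact: W0 | exact: weight_sum1 Wf].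
Qed.

Lemma proj_linear x : linear (proj x).
Proof.
move=> c f g; apply: proj_unique; first by apply: W_lin; exact: proj_weight.
have -> : c *: f + g - (c *: proj x f + proj x g) = c *: (f - proj x f) + (g - proj x g).
  by rewrite opprD addrACA scalerBr.
apply: weight_sum_add; last by case: (projP x g).
case: (projP x f) => _; apply: (@weight_sum_map W _ _ ( *:%R c)).
- by move=> a b; rewrite scalerDr.
- by rewrite scaler0.
move=> y h yx Wh; apply: (weight_sum1 yx).
by rewrite -[c *: h]addr0; exact: W_lin.
Qed.

Lemma proj_add x f g : proj x (f + g) = proj x f + proj x g.
Proof. by have := proj_linear x 1 f g; rewrite !scale1r. Qed.

Lemma proj0 x : proj x 0 = 0.
Proof. exact: proj_id. Qed.

Lemma proj_sum x I (s : seq I) (F : I -> P) :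
  proj x (\sum_(i <- s) F i) = \sum_(i <- s) proj x (F i).
Proof. exact: (big_morph _ (proj_add x) (proj0 x)). Qed.

Lemma proj_support f : exists2 s, uniq s & f = \sum_(x <- s) proj x f.
Proof.
have [t [tW Ef]] := W_total f.
have [s st] : exists s : seq V, forall g, g \in t -> exists2 x, x \in s & W x g.
  elim: t {Ef} tW => [|g t IH] tW; first by exists [::].
  have [h ht|s st] := IH; first by apply: tW; rewrite inE ht orbT.
  have [|x _ Wg] := tW g; first by rewrite inE eqxx.
  exists (x :: s) => h; rewrite inE => /orP[/eqP->|/st[y ys Wh]].
    by exists x; rewrite // inE eqxx.
  by exists y; rewrite // inE ys orbT.
exists (undup s); first exact: undup_uniq.
rewrite [RHS](_ : _ = \sum_(x <- undup s) \sum_(g <- t) proj x g); last first.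
  by apply: eq_bigr => x _; rewrite Ef proj_sum.
rewrite exchange_big Ef; apply: eq_big_seq => g /st[x xs Wg] /=.
rewrite (bigD1_seq x) ?mem_undup ?undup_uniq //= big1 ?addr0 ?proj_id // => y /eqP yx.
by rewrite (proj_other _ Wg) // => xy; apply: yx.
Qed.

(** The operators [T x] are glued along the decomposition. The chosen lists [supp f] are not
    additive in [f], so linearity is checked on a common larger list, where the extra components are
    zero. *)
Lemma weight_operator (T : V -> P -> P) : (forall x, linear (T x)) ->
  exists2 D : P -> P, linear D & forall x f, W x f -> D f = T x f.
Proof.
move=> linT.
have T0 x : T x 0 = 0.
  have := linT x 1 0 0; rewrite !scale1r !addr0 -[X in X = _]addr0.
  by move/addrI.
have ex f : exists s, uniq s /\ f = \sum_(x <- s) proj x f.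
  by have [s] := proj_support f; exists s.
pose supp f := proj1_sig (constructive_indefinite_description _ (ex f)).
have suppP f : uniq (supp f) /\ f = \sum_(x <- supp f) proj x f.
  by rewrite /supp; case: constructive_indefinite_description.
have supp0 x f : x \notin supp f -> proj x f = 0.
  have [_ Ef] := suppP f; move=> xf; rewrite Ef proj_sum big_seq big1 // => y ys.
  by apply: (proj_other _ (proj_weight y f)) => yx; rewrite -yx ys in xf.
have supp_wide f s : uniq s -> {subset supp f <= s} ->
    \sum_(x <- supp f) T x (proj x f) = \sum_(x <- s) T x (proj x f).
  move=> us sub; rewrite [RHS](bigID (mem (supp f))) /= [X in _ = _ + X]big1 ?addr0; last first.
    by move=> x /supp0 ->.
  rewrite -[RHS]big_filter; apply: perm_big; apply: uniq_perm.
  - by case: (suppP f).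
  - exact: filter_uniq.
  by move=> x; rewrite mem_filter; apply/idP/andP => [xf|[]//]; rewrite xf sub.
exists (fun f => \sum_(x <- supp f) T x (proj x f)) => [c f g|x f Wf].
  pose s := undup (supp (c *: f + g) ++ supp f ++ supp g).
  rewrite !(supp_wide _ s) ?undup_uniq //; try by move=> x xs; rewrite mem_undup !mem_cat xs ?orbT.
  rewrite scaler_sumr -big_split; apply: eq_bigr => x _ /=.
  by rewrite proj_linear linT.
rewrite (supp_wide _ (undup (x :: supp f))) ?undup_uniq //; last first.
  by move=> y ys; rewrite mem_undup inE ys orbT.
rewrite (bigD1_seq x) ?undup_uniq ?mem_undup ?inE ?eqxx //= proj_id // big1 ?addr0 // => y /eqP yx.
by rewrite (proj_other _ Wf) // => xy; apply: yx.
Qed.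

End Projections.
End WeightSums.

(** * Commuting diagonalisable vector fields *)

Section DiagonalDerivations.
Variables (k : fieldType) (n : nat).
Hypothesis char0 : [pchar k] =i pred0.
Local Notation P := {mpoly k[n]}.
Variables (D : 'I_n -> P -> P) (dv : 'rV[k]_n).
Hypothesis dD : forall i, derivation (D i).
Hypothesis divD : forall i, divergence (D i) = (dv 0 i)%:MP.
Hypothesis nondeg : forall b : 'I_n -> P,
  (forall i, \sum_j b j * D i 'X_j = 0) -> forall j, b j = 0.

Definition joint_eigen (c : 'rV[k]_n) (f : P) : Prop := forall i, D i f = c 0 i *: f.
Local Notation W := joint_eigen.
Hypothesis W_total : forall f, weight_sum W (fun=> True) f.

Lemma joint_eigen_indep : weights_independent W.
Proof.
apply: (@eigen_independent _ _ _ _ D (fun i (c : 'rV_n) => c 0 i)) => [i|c d cd].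
  exact: der_linear.
apply: NNPP => ne; apply: cd; apply/rowP => i; apply/eqP; apply: contraT => /eqP cd.
by case: ne; exists i.
Qed.

Lemma joint_eigenM c d f g : W c f -> W d g -> W (c + d) (f * g).
Proof.
move=> Wf Wg i; rewrite (derM (dD i)) Wf Wg mxE scalerDl.
by rewrite scalerAl scalerAr.
Qed.

Lemma joint_eigen1 : W 0 1.
Proof. by move=> i; rewrite (der1 (dD i)) mxE scale0r. Qed.

Lemma joint_eigen_prod (I : Type) (s : seq I) (c : I -> 'rV_n) (f : I -> P) (b : I -> nat) :
  (forall i, W (c i) (f i)) -> W (\sum_(i <- s) c i *+ b i) (\prod_(i <- s) f i ^+ b i).
Proof.
move=> Wf; apply: (big_ind2 W) => [||i _]; [exact: joint_eigen1 | by move=> *; exact: joint_eigenM |].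
elim: (b i) => [|m IH]; first by rewrite mulr0n expr0; exact: joint_eigen1.
by rewrite mulrS exprS; apply: joint_eigenM.
Qed.

(** All the [D i] kill f/g, and they span the tangent space at a general point, so f/g has zero
    gradient. *)
Lemma joint_eigen_line c f g : W c f -> W c g -> g != 0 -> exists a, f = a *: g.
Proof.
move=> Wf Wg g0; apply: (proportional char0) => // j; apply/eqP; rewrite -subr_eq0; apply/eqP.
apply: (nondeg (b := fun j => f * g^`M(j) - g * f^`M(j))) => {j} i.
have := der_expand (dD i) f; have := der_expand (dD i) g; rewrite Wf Wg => Dg Df.
transitivity (f * (c 0 i *: g) - g * (c 0 i *: f)); last first.
  by rewrite -!scalerAr mulrC subrr.
rewrite Dg Df !mulr_sumr -sumrB; apply: eq_bigr => j _; ring.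
Qed.

Lemma joint_eigen0_const f : W 0 f -> f = (f@_0)%:MP.
Proof.
move=> Wf; have [a ->] := joint_eigen_line Wf joint_eigen1 (oner_neq0 _).
by rewrite -mul_mpolyC mulr1 mcoeffC eqxx mulr1.
Qed.

Local Notation I := (weight_sum W (fun c => c <> 0)).

(** Only a product of weight vectors with opposite weights could leave the span. Such a product is
    constant, and a nonzero constant would make both factors units, hence constants of weight
    zero. *)
Lemma eigen_ideal f g : I f -> I (g * f).
Proof.
move=> If; have W2 c d a b : c <> 0 -> W c a -> W d b -> I (b * a).
  move=> c0 Wa Wb; have Wba := joint_eigenM Wb Wa.
  have [dc|dc] := eqVneq (d + c) 0; last by apply: weight_sum1 Wba; apply/eqP.
  rewrite dc in Wba; have Eba := joint_eigen0_const Wba.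
  have [e0|e0] := eqVneq (b * a)@_0 0; first by rewrite Eba e0; exact: weight_sum0.
  rewrite [X in X = _]mulrC in Eba.
  have Ea := mpoly_unit_const e0 Eba.
  suff a0 : a = 0 by rewrite a0 mulr0; exact: weight_sum0.
  apply/eqP; apply: contraT => a0; case: c0; apply/rowP => i; rewrite mxE.
  have := Wa i; rewrite Ea (derC (dD i)) -Ea => /esym/eqP.
  by rewrite scaler_eq0 (negbTE a0) orbF => /eqP.
apply: (@weight_sum_map _ _ _ W _ _ (fun a => g * a)) If => [a b||].
- exact: mulrDr.
- exact: mulr0.
move=> c a c0 Wa.
apply: (@weight_sum_map _ _ _ W _ _ (fun b => b * a)) (W_total g) => [b b'||].
- exact: mulrDl.
- exact: mul0r.
by move=> d b _ Wb; exact: W2 Wa Wb.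
Qed.

(** The coordinates of [p] are the weight-zero parts of the variables, which are constants. Then
    every f - f(p) lies in the ideal; for [f] of nonzero weight so does the constant f(p), which
    must vanish by independence of weights. *)
Lemma eigen_point : exists p : 'I_n -> k, forall c f, c <> 0 -> W c f -> f.@[p] = 0.
Proof.
have [j|p pI] := @fin_all_exists 'I_n (fun=> k) (fun j a => I ('X_j - a%:MP)).
  have [f1 [f2 [E [s [sW E1]] I2]]] := weight_sum_split (fun c => c = 0) (W_total 'X_j).
  exists f1@_0; rewrite E -joint_eigen0_const ?addrK 1?addrC ?addKr //.
  rewrite E1 big_seq; apply: (big_ind (W 0)).
  - by move=> i; rewrite (der0 (dD i)) scaler0.
  - by move=> a b Wa Wb i; rewrite (der_add (dD i)) Wa Wb scalerDr.
  by move=> g /sW[c ->].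
have Ip f : I (f - f.@[p]%:MP).
  elim/mpoly_ring_ind: f => [c|i|f g If Ig|f g If Ig].
  - by rewrite mevalC subrr; exact: weight_sum0.
  - by rewrite mevalXU.
  - rewrite mevalD mpolyCD opprD addrACA; exact: weight_sum_add.
  rewrite mevalM mpolyCM.
  have -> : f * g - f.@[p]%:MP * g.@[p]%:MP =
     g * (f - f.@[p]%:MP) + f.@[p]%:MP * (g - g.@[p]%:MP) by ring.
  by apply: weight_sum_add; exact: eigen_ideal.
exists p => c f c0 Wf.
apply/eqP; rewrite -(mpolyC_eq0 n); apply/eqP.
apply: (joint_eigen_indep (x := 0)).
  by move=> i; rewrite (derC (dD i)) mxE scale0r.
have -> : f.@[p]%:MP = f + (-1)%:MP * (f - f.@[p]%:MP) by rewrite mpolyCN mpolyC1; ring.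
by apply: weight_sum_add; [exact: weight_sum1 Wf | exact: eigen_ideal].
Qed.

Lemma joint_eigen_jacobian (c : 'I_n -> 'rV_n) (y : 'I_n -> P) :
  (forall j, W (c j) (y j)) -> W (\sum_j c j - dv) (jacobian y).
Proof.
move=> Wy i; rewrite (der_jacobian _ (dD i)) divD mul_mpolyC !mxE scalerBl.
rewrite summxE scaler_suml; congr (_ - _).
apply: eq_bigr => j _; rewrite Wy (derZ (derivation_subst y j)).
by rewrite subst_at_id.
Qed.

(* The derivations f |-> jacobian (subst_at y i f) lower weights by the weight of
   y i and together compute the gradient of f; so a weight vector whose weight is
   not a sum of weights of the y i vanishes to infinite order at the fixed point. *)
Lemma diagonal_coordinates : exists (y q : 'I_n -> P),
  [/\ forall j, exists c, W c (y j),
      exists2 a, a != 0 & jacobian y = a%:MP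
    & forall j, 'X_j = q j \mPo [tuple y i | i < n]].
Proof.
have [p pW] := eigen_point.
have [y [Wy Jp]] : exists y : 'I_n -> P, (forall j, exists c, W c (y j)) /\ (jacobian y).@[p] != 0.
  have := @jacobian_span k n (fun f => exists c, W c f)
    (fun J => J.@[p] = 0 \/ exists y : 'I_n -> P,
       (forall j, exists c, W c (y j)) /\ (jacobian y).@[p] != 0) _ _ _ _ (fun i => 'X_i).
  case.
  - move=> f; have [s [sW Ef]] := W_total f; exists s; split=> // g /sW[c _ Wg].
    by exists c.
  - by left; rewrite meval0.
  - by move=> f g [f0|yf] [g0|yg]; [left; rewrite mevalD f0 g0 addr0 | right | right | right].
  - move=> y Wy; have [e|e] := classic ((jacobian y).@[p] = 0); first by left; exact: e.
    by right; exists y; split; [exact: Wy | exact/eqP].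
  - by rewrite jacobian_id meval1 => /eqP; rewrite oner_eq0.
  by [].
have [c {}Wy] := fin_all_exists Wy.
have WJ := joint_eigen_jacobian Wy.
(* A nonzero weight would make the jacobian vanish at [p]; having weight zero, it is constant. *)
have J0 : \sum_j c j - dv = 0.
  by apply/eqP; apply: contraNT Jp => /eqP J0; rewrite (pW _ _ J0 WJ).
rewrite J0 in WJ; have JE := joint_eigen0_const WJ.
set a := _@_0 in JE.
have a0 : a != 0 by move: Jp; rewrite JE mevalC.
have WD i d f : W d f -> W (d - c i) (jacobian (subst_at y i f)).
  move=> Wf; pose c' j := if j == i then d else c j.
  have -> : d - c i = \sum_j c' j - dv.
    move/eqP: J0; rewrite subr_eq0 => /eqP <-.
    rewrite (bigD1 i) //= [\sum_j c j](bigD1 i) //= /c' eqxx opprD addrACA.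
    rewrite [X in _ + (X - _)](eq_bigr c) ?subrr ?addr0 // => j /negbTE -> //.
  by apply: joint_eigen_jacobian => j; rewrite /subst_at /c'; case: eqP.
pose gen d := exists b : 'I_n -> nat, d = \sum_i c i *+ b i.
have van m d f : W d f -> ~ gen d -> vanishing p m f.
  elim: m d f => [|m IH] d f Wf ng; split=> //; try move=> j.
  - apply: pW Wf => d0; apply: ng; exists (fun=> 0%N).
    by rewrite d0 big1 // => i _; rewrite mulr0n.
  - apply: pW Wf => d0; apply: ng; exists (fun=> 0%N).
    by rewrite d0 big1 // => i _; rewrite mulr0n.
  apply: (vanishing_mulI Jp); rewrite gradient_cramer.
  apply: vanishing_sum => i; apply: vanishing_mul.
  apply: IH (WD i _ _ Wf) _ => -[b Eb]; apply: ng.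
  exists (fun l => b l + (l == i))%N.
  move/eqP: Eb; rewrite subr_eq => /eqP ->.
  under [RHS]eq_bigr do rewrite mulrnDr.
  rewrite big_split /=; congr (_ + _).
  rewrite (bigD1 i) //= eqxx mulr1n big1 ?addr0 // => l /negbTE ->.
  by rewrite mulr0n.
have y0 i : y i != 0.
  apply: contraNneq a0 => yi; rewrite -(mpolyC_eq0 n) -JE -(subst_at_id y i) yi.
  by rewrite (der0 (derivation_subst y i)).
have span f : exists q, f = q \mPo [tuple y i | i < n].
  have [s [sW ->]] := W_total f; elim: s sW => [|g s IH] sW.
    by exists 0; rewrite comp_mpoly0 big_nil.
  have [h hs|q Eq] := IH; first by apply: sW; rewrite inE hs orbT.
  have [|d _ Wg] := sW g; first by rewrite inE eqxx.
  have [g0|g0] := eqVneq g 0; first by exists q; rewrite big_cons g0 add0r.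
  have [b Eb] : gen d.
    apply: NNPP => ng; move/negP: g0; apply; apply/eqP.
    by apply: (@vanishing_all _ _ char0 p) => m; exact: van Wg ng.
  have Wb := joint_eigen_prod (index_enum 'I_n) b Wy; rewrite -Eb in Wb.
  have [|e Ee] := joint_eigen_line Wg Wb.
    by apply/prodf_neq0 => i _; rewrite expf_neq0.
  exists (e *: 'X_[[multinom b i | i < n]] + q).
  rewrite big_cons comp_mpolyD comp_mpolyZ comp_mpolyX -Eq Ee; congr (_ *: _ + _).
  by apply: eq_bigr => i _; rewrite tnth_mktuple mnmE.
have [q Eq] := fin_all_exists (fun j => span 'X_j).
by exists y, q; split=> //; [move=> j; exists (c j) | exists a].
Qed.

End DiagonalDerivations.

(** * Gradings by characters *)

Section Grading.
Variables (k : fieldType) (n d : nat).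
Hypothesis char0 : [pchar k] =i pred0.
Local Notation P := {mpoly k[n]}.
Local Notation wt := 'rV[int]_d.

(** [gr_jacobian] leaves the weight [e] open, since it depends on the jacobian of the action.
    [gr_faithful] says that no nontrivial one-parameter subgroup pairs to zero with all occurring
    weights. *)
Record grading (W : wt -> P -> Prop) : Prop := Grading {
  gr_lin : forall x c f g, W x f -> W x g -> W x (c *: f + g);
  gr0 : forall x, W x 0;
  gr1 : W 0 1;
  grM : forall x y f g, W x f -> W y g -> W (x + y) (f * g);
  gr_indep : weights_independent W;
  gr_total : forall f, weight_sum W (fun=> True) f;
  gr_jacobian : forall (x : 'I_n -> wt) (y : 'I_n -> P),
    (forall j, W (x j) (y j)) -> exists e, W e (jacobian y);
  gr_faithful : forall l : wt,
    (forall x f, W x f -> f != 0 -> \sum_i l 0 i * x 0 i = 0) -> l = 0 }.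

Variable W : wt -> P -> Prop.
Hypothesis gW : grading W.

Local Notation Wlin := (gr_lin gW).

Definition gproj : wt -> P -> P := proj Wlin (gr0 gW) (gr_total gW).
Local Notation Wproj := gproj.
Lemma gproj_linear x : linear (Wproj x). Proof. exact: proj_linear (gr_indep gW) _ _. Qed.
Lemma gproj0 x : Wproj x 0 = 0. Proof. exact: proj0 (gr_indep gW) _ _. Qed.
Lemma gproj_id x f : W x f -> Wproj x f = f. Proof. exact: proj_id (gr_indep gW) _ _ _. Qed.
Lemma gproj_other x y f : y <> x -> W y f -> Wproj x f = 0.
Proof. exact: proj_other (gr_indep gW) _ _ _ _. Qed.
Lemma gproj_weight x f : W x (Wproj x f). Proof. exact: proj_weight. Qed.
Lemma gproj_support f : exists2 s, uniq s & f = \sum_(x <- s) Wproj x f.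
Proof. exact: proj_support (gr_indep gW) _ _. Qed.

Lemma gr_scale x c f : W x f -> W x (c *: f).
Proof. by move=> Wf; rewrite -[_ *: _]addr0; apply: Wlin => //; exact: gr0. Qed.

Lemma gr_add x f g : W x f -> W x g -> W x (f + g).
Proof. by move=> Wf; rewrite -[f]scale1r; exact: Wlin. Qed.

Lemma gr_exp x f m : W x f -> W (x *+ m) (f ^+ m).
Proof.
move=> Wf; elim: m => [|m IH]; first by rewrite mulr0n expr0; exact: gr1.
by rewrite mulrS exprS; exact: grM.
Qed.

Lemma gr_unique x y f : W x f -> W y f -> f != 0 -> x = y.
Proof.
move=> Wx Wy f0; apply: NNPP => xy; move/negP: f0; apply; apply/eqP.
by apply: (gr_indep gW Wx); apply: weight_sum1 Wy => yx; apply: xy.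
Qed.

Lemma linear_eq (A B : P -> P) : linear A -> linear B ->
  (forall x f, W x f -> A f = B f) -> forall f, A f = B f.
Proof.
move=> lA lB AB f; have [s [sW ->]] := gr_total gW f.
have l0 (C : P -> P) : linear C -> C 0 = 0.
  by move=> lC; have := lC (-1) 0 0; rewrite scaler0 addr0 scaleN1r addNr.
have lD (C : P -> P) : linear C -> {morph C : a b / a + b}.
  by move=> lC a b; have := lC 1 a b; rewrite !scale1r.
rewrite (big_morph A (lD _ lA) (l0 _ lA)) (big_morph B (lD _ lB) (l0 _ lB)).
by apply: eq_big_seq => g /sW[x _]; exact: AB.
Qed.

Lemma derivation_of_weights (D : P -> P) : linear D ->
  (forall x y f g, W x f -> W y g -> D (f * g) = D f * g + f * D g) -> derivation D.
Proof.
move=> lD DM; split=> // f g.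
apply: (@linear_eq (fun f => D (f * g)) (fun f => D f * g + f * D g)).
- by move=> c a b; rewrite mulrDl -scalerAl lD.
- by move=> c a b; rewrite lD !mulrDl -!scalerAl scalerDr addrACA.
move=> x {}f Wf.
apply: (@linear_eq (fun g => D (f * g)) (fun g => D f * g + f * D g)).
- by move=> c a b; rewrite mulrDr -scalerAr lD.
- by move=> c a b; rewrite lD !mulrDr -!scalerAr scalerDr addrACA.
by move=> y {}g Wg; exact: DM Wf Wg.
Qed.

(** These are the infinitesimal generators of the factors of the torus. Additivity of weights under
    products is the Leibniz rule. *)
Lemma weight_derivations : exists D : 'I_d -> P -> P,
  forall i, derivation (D i) /\ forall x f, W x f -> D i f = (x 0 i)%:~R *: f.
Proof.
apply: (@fin_all_exists 'I_d (fun=> P -> P)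
  (fun i D => derivation D /\ forall x f, W x f -> D f = (x 0 i)%:~R *: f)) => i.
have [|D lD DE] := weight_operator Wlin (gr0 gW) (gr_indep gW) (gr_total gW)
  (T := fun x f => (x 0 i)%:~R *: f).
  by move=> x c f g; rewrite scalerDr !scalerA mulrC.
exists D; split=> //; apply: derivation_of_weights => // x y f g Wf Wg.
rewrite (DE _ _ (grM gW Wf Wg)) (DE _ _ Wf) (DE _ _ Wg) mxE rmorphD /= scalerDl.
by rewrite scalerAl scalerAr.
Qed.

Variable D : 'I_d -> P -> P.
Hypothesis dD : forall i, derivation (D i).
Hypothesis DW : forall i x f, W x f -> D i f = (x 0 i)%:~R *: f.

(** Each nonzero component of [f] has the eigenvalues [c i], and integers stay distinct in
    characteristic zero, so there is only one such component. *)
Lemma eigen_weight (c : 'I_d -> k) f : f != 0 -> (forall i, D i f = c i *: f) ->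
  exists2 x, W x f & forall i, (x 0 i)%:~R = c i.
Proof.
move=> f0 Df.
have pD x i g : Wproj x (D i g) = (x 0 i)%:~R *: Wproj x g.
  apply: (@linear_eq (fun g => Wproj x (D i g)) (fun g => (x 0 i)%:~R *: Wproj x g)).
  - by move=> a b b'; rewrite (der_linear (dD i)) gproj_linear.
  - by move=> a b b'; rewrite gproj_linear scalerDr !scalerA mulrC.
  move=> y h Wh; rewrite (DW _ Wh).
  have [<-|/eqP yx] := eqVneq y x; first by rewrite !gproj_id //; exact: gr_scale.
  by rewrite !(gproj_other (y := y)) ?scaler0 //; exact: gr_scale.
have px x : Wproj x f != 0 -> forall i, (x 0 i)%:~R = c i.
  move=> nz i; have := pD x i f; rewrite Df -[_ *: f]addr0 gproj_linear gproj0 addr0.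
  by move/eqP; rewrite -subr_eq0 -scalerBl scaler_eq0 (negbTE nz) orbF subr_eq0 => /eqP.
have [s us Ef] := gproj_support f.
have [x xs nz] : exists2 x, x \in s & Wproj x f != 0.
  apply/hasP; apply: contraNT f0 => /hasPn h; rewrite Ef big_seq big1 // => x /h.
  by rewrite negbK => /eqP.
exists x; last exact: px.
suff -> : f = Wproj x f by exact: gproj_weight.
rewrite {1}Ef (bigD1_seq x) //= big1 ?addr0 // => y yx; apply/eqP.
apply: contraNT yx => ny; apply/eqP/rowP => i; apply: (intr_inj char0).
by rewrite /= (px _ nz) (px _ ny).
Qed.

Lemma jacobian_weights (x : 'I_n -> wt) (y : 'I_n -> P) (l : 'I_d -> k) :
  (forall j, W (x j) (y j)) -> jacobian y != 0 ->
  (forall j, \sum_i l i * (x j 0 i)%:~R = 0) ->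
  forall f, \sum_i (l i)%:MP * D i f = 0.
Proof.
move=> Wy J0 lx f; have dl := derivation_comb (fun i => (l i)%:MP) dD.
have := der_subst y f dl; rewrite [RHS]big1 => [/eqP|j _].
  by rewrite mulf_eq0 (negbTE J0) => /eqP.
under eq_bigr do rewrite (DW _ (Wy j)) mul_mpolyC scalerA.
by rewrite -scaler_suml lx scale0r mul0r.
Qed.

Lemma exists_jacobian : exists (x : 'I_n -> wt) (y : 'I_n -> P),
  (forall j, W (x j) (y j)) /\ jacobian y != 0.
Proof.
suff [y [Wy J0]] : exists y : 'I_n -> P, (forall j, exists x, W x (y j)) /\ jacobian y != 0.
  by have [x Wx] := fin_all_exists Wy; exists x, y.
have := @jacobian_span k n (fun f => exists x, W x f)
  (fun J => J = 0 \/ exists y : 'I_n -> P,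
     (forall j, exists c, W c (y j)) /\ jacobian y != 0) _ _ _ _ (fun i => 'X_i).
case.
- move=> f; have [s [sW Ef]] := gr_total gW f; exists s; split=> // g /sW[c _ Wg].
  by exists c.
- by left.
- by move=> f g [f0|yf] [g0|yg]; [left; rewrite f0 g0 addr0 | right | right | right].
- move=> y Wy; have [e|e] := classic (jacobian y = 0); first by left; exact: e.
  by right; exists y; split; [exact: Wy | exact/eqP].
- by rewrite jacobian_id => /eqP; rewrite oner_eq0.
by [].
Qed.

(** By [der_jacobian], the divergence is the sum of the weights of the entries minus the weight of
    their jacobian, for any weight vectors with nonzero jacobian. *)
Lemma divergence_const : exists v : 'rV[k]_d, forall i, divergence (D i) = (v 0 i)%:MP.
Proof.
have [x [y [Wy J0]]] := exists_jacobian.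
have [e We] := gr_jacobian gW Wy.
exists (\row_i (\sum_j (x j 0 i)%:~R - (e 0 i)%:~R)) => i.
apply: (mulIf J0); have := der_jacobian y (dD i); rewrite (DW i We) => E.
have -> : divergence (D i) * jacobian y =
    \sum_j jacobian (subst_at y j (D i (y j))) - (e 0 i)%:~R *: jacobian y.
  by rewrite E opprB addrC subrK.
rewrite mxE mul_mpolyC scalerBl; congr (_ - _); rewrite scaler_suml.
apply: eq_bigr => j _; rewrite (DW i (Wy j)) (derZ (derivation_subst y j)).
by rewrite subst_at_id.
Qed.

Lemma divergence_weight (x : 'I_n -> wt) (y : 'I_n -> P) i :
  (forall j, W (x j) (y j)) -> jacobian y != 0 -> W (\sum_j x j) (jacobian y) ->
  divergence (D i) = 0.
Proof.
move=> Wy J0 WJ; apply: (mulIf J0); rewrite mul0r.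
have := der_jacobian y (dD i); rewrite (DW i WJ).
rewrite (eq_bigr (fun j => (x j 0 i)%:~R *: jacobian y)) => [|j _]; last first.
  by rewrite (DW i (Wy j)) (derZ (derivation_subst y j)) subst_at_id.
rewrite -scaler_suml summxE rmorph_sum /=.
by move/esym/eqP; rewrite subr_eq addrC -subr_eq subrr => /eqP <-.
Qed.

(** The field \sum_i l_i D_i kills all [y j], hence everything by Cramer's rule, so [l] pairs to
    zero with every weight and faithfulness applies. *)
Lemma weights_int_kernel (x : 'I_n -> wt) (y : 'I_n -> P) (l : wt) :
  (forall j, W (x j) (y j)) -> jacobian y != 0 ->
  (forall j, \sum_i l 0 i * x j 0 i = 0) -> l = 0.
Proof.
move=> Wy J0 lx; apply: (gr_faithful gW) => z f Wf f0.
have := jacobian_weights (l := fun i => (l 0 i)%:~R) Wy J0 _ f.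
under eq_bigr do rewrite (DW _ Wf) mul_mpolyC scalerA -rmorphM /=.
rewrite -scaler_suml -rmorph_sum /= => /(_ _)/eqP; rewrite scaler_eq0 (negbTE f0) orbF.
move=> E; have /eqP E' : (\sum_i l 0 i * z 0 i)%:~R == 0 :> k.
  apply: E => j; rewrite -[RHS](rmorph0 (intr : int -> k)) -(lx j) rmorph_sum.
  by apply: eq_bigr => i _; rewrite rmorphM.
by apply: (intr_inj char0); rewrite /= E'.
Qed.

End Grading.

Lemma det_unit_kernel (R : idomainType) m (M : 'M[R]_m) (b : 'I_m -> R) : \det M != 0 ->
  (forall i, \sum_j b j * M i j = 0) -> forall j, b j = 0.
Proof.
move=> M0 bM j.
have /det0P Q : \det M^T != 0 by rewrite det_tr.
have [b0|b0] := eqVneq (\row_j b j) 0; first by move/rowP/(_ j): b0; rewrite !mxE.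
case: Q; exists (\row_j b j) => //; apply/rowP => i; rewrite !mxE -[RHS](bM i).
by apply: eq_bigr => l _; rewrite !mxE.
Qed.

(** * Coordinates for a torus of full dimension *)

Section Toric.
Variables (k : fieldType) (n : nat).
Hypothesis char0 : [pchar k] =i pred0.
Local Notation P := {mpoly k[n]}.
Variable W : 'rV[int]_n -> P -> Prop.
Hypothesis gW : grading W.

Lemma toric_weights_det (x : 'I_n -> 'rV[int]_n) (y : 'I_n -> P) :
  (forall j, W (x j) (y j)) -> jacobian y != 0 -> \det (\matrix_(i, j) x i 0 j) != 0.
Proof.
move=> Wy J0; have [D /all_and2[dD DW]] := weight_derivations gW.
rewrite -det_tr; apply/det0P => -[l l0 lX]; move/eqP: l0; apply.
apply: (weights_int_kernel char0 gW dD DW Wy J0) => j.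
by move/rowP/(_ j): lX; rewrite !mxE => E; rewrite -[RHS]E; apply: eq_bigr => i _; rewrite !mxE.
Qed.

Lemma toric_coordinates : exists (y q : 'I_n -> P),
  [/\ forall j, exists c, W c (y j),
      exists2 a, a != 0 & jacobian y = a%:MP
    & forall j, 'X_j = q j \mPo [tuple y i | i < n]].
Proof.
have [D /all_and2[dD DW]] := weight_derivations gW.
have [v divD] := divergence_const gW dD DW.
have [x [y [Wy J0]]] := exists_jacobian gW.
have y0 j : y j != 0.
  apply: contraNneq J0 => yj; rewrite -(subst_at_id y j) yj.
  by rewrite (der0 (derivation_subst y j)).
pose X := \matrix_(i, j) x j 0 i : 'M[int]_n.
have X0 : \det X != 0.
  have := toric_weights_det Wy J0; rewrite -det_tr.
  by congr (\det _ != 0); apply/matrixP => i j; rewrite !mxE.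
pose M := \matrix_(i, j) D i 'X_j : 'M[P]_n.
have M0 : \det M != 0.
  (* The product has entries D_i y_j, that is, a weight times y_j; it factors into the weight matrix
     and a diagonal matrix, both nonsingular. *)
  have : \det (M *m (jacmx y)^T) != 0.
    have -> : M *m (jacmx y)^T = map_mx (@mpolyC n k \o intr) X *m diag_mx (\row_j y j).
      apply/matrixP => i j; rewrite mul_mx_diag !mxE /= mul_mpolyC -(DW _ _ _ (Wy j)).
      by rewrite (der_expand (dD i)); apply: eq_bigr => l _; rewrite !mxE.
    rewrite det_mulmx det_diag det_map_mx /= mulf_neq0 //.
      rewrite mpolyC_eq0; apply: contra X0 => /eqP E.
      by apply/eqP/(intr_inj char0); rewrite /= E.
    by apply/prodf_neq0 => j _; rewrite mxE.
  by rewrite det_mulmx; apply: contraNneq => ->; rewrite mul0r.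
have nd b : (forall i, \sum_j b j * D i 'X_j = 0) -> forall j, b j = 0.
  move=> bD; apply: (det_unit_kernel M0) => i; rewrite -[RHS](bD i).
  by apply: eq_bigr => j _; rewrite mxE.
have tot f : weight_sum (joint_eigen D) (fun=> True) f.
  have [s [sW Ef]] := gr_total gW f; exists s; split=> // g /sW[c _ Wg].
  by exists (\row_i (c 0 i)%:~R) => // i; rewrite (DW _ _ _ Wg) mxE.
have [z [q [Wz [a a0 Jz] Eq]]] := diagonal_coordinates char0 dD divD nd tot.
exists z, q; split=> //; last by exists a.
move=> j; have [c Wc] := Wz j.
have [|w Ww _] := eigen_weight char0 gW dD DW (c := fun i => c 0 i) (f := z j) _ Wc; last by exists w.
apply: contraNneq a0 => zj; rewrite -(mpolyC_eq0 n) -Jz -(subst_at_id z j) zj.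
by rewrite (der0 (derivation_subst z j)).
Qed.

End Toric.

(** * The group of weights in codimension one *)

Section CodimOne.
Variables (k : fieldType) (d : nat).
Hypothesis char0 : [pchar k] =i pred0.
Local Notation n := d.+1.
Local Notation P := {mpoly k[n]}.
Local Notation wt := 'rV[int]_d.
Variable W : wt -> P -> Prop.
Hypothesis gW : grading W.
Hypothesis gW_jac : forall (x : 'I_n -> wt) (y : 'I_n -> P),
  (forall j, W (x j) (y j)) -> W (\sum_j x j) (jacobian y).

(* Expand 1 = jacobian x multilinearly and take the weight-zero part. *)
Lemma exists_jacobian0 : exists (x : 'I_n -> wt) (y : 'I_n -> P),
  [/\ forall j, W (x j) (y j), \sum_j x j = 0 & jacobian y != 0].
Proof.
have := @jacobian_span k n (fun f => exists x, W x f)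
  (fun J => weight_sum W (fun c => c <> 0) J \/ exists (x : 'I_n -> wt) (y : 'I_n -> P),
     [/\ forall j, W (x j) (y j), \sum_j x j = 0 & jacobian y != 0])
  _ _ _ _ (fun i => 'X_i).
case.
- move=> f; have [s [sW Ef]] := gr_total gW f; exists s; split=> // g /sW[c _ Wg].
  by exists c.
- by left; exact: weight_sum0.
- by move=> f g [f0|yf] [g0|yg]; [left; exact: weight_sum_add | right | right | right].
- move=> y /fin_all_exists[x Wy]; have WJ := gW_jac Wy.
  have [s0|s0] := classic (\sum_j x j = 0); last by left; exact: weight_sum1 WJ.
  have [e|e] := classic (jacobian y = 0); first by left; rewrite e; exact: weight_sum0.
  by right; exists x, y; split=> //; exact/eqP.
- rewrite jacobian_id => W1; have := gr_indep gW (gr1 gW) W1.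
  by move/eqP; rewrite oner_eq0.
by [].
Qed.

Variables (D : 'I_d -> P -> P).
Hypothesis dD : forall i, derivation (D i).
Hypothesis DW : forall i x f, W x f -> D i f = (x 0 i)%:~R *: f.
Variables (x : 'I_n -> wt) (y : 'I_n -> P).
Hypothesis Wy : forall j, W (x j) (y j).
Hypothesis x_sum : \sum_j x j = 0.
Hypothesis y_jac : jacobian y != 0.

Let X : 'M[int]_d := \matrix_(i, l) x (fintype.lift ord0 i) 0 l.

(** The weight omitted from [X] is minus the sum of the others, so a functional killing the rows of
    [X] kills all [x j]. *)
Lemma weights_det : \det X != 0.
Proof.
rewrite -det_tr; apply/det0P => -[l l0 lX]; move/eqP: l0; apply.
have lx j : \sum_i l 0 i * x (fintype.lift ord0 j) 0 i = 0.
  by move/rowP/(_ j): lX; rewrite !mxE => E; rewrite -[RHS]E; apply: eq_bigr => i _; rewrite !mxE.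
apply: (weights_int_kernel char0 gW dD DW Wy y_jac) => j.
case: (unliftP ord0 j) => [i -> //|->].
move/eqP: x_sum; rewrite big_ord_recl /= addr_eq0 => /eqP ->.
under eq_bigr do rewrite mxE mulrN summxE mulr_sumr.
rewrite sumrN exchange_big big1 ?oppr0 // => i _; exact: lx.
Qed.

Definition weight_of (c : wt) : Prop := exists2 f, W c f & f != 0.

Lemma weight_of0 : weight_of 0.
Proof. by exists 1; [exact: gr1 | exact: oner_neq0]. Qed.

Lemma weight_of_add a b : weight_of a -> weight_of b -> weight_of (a + b).
Proof.
by move=> [f Wf f0] [g Wg g0]; exists (f * g); [exact: grM | exact: mulf_neq0].
Qed.

Lemma weight_of_muln a m : weight_of a -> weight_of (a *+ m).
Proof.
move=> Ha; elim: m => [|m IH]; first by rewrite mulr0n; exact: weight_of0.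
by rewrite mulrS; exact: weight_of_add.
Qed.

Lemma weight_of_sum I (s : seq I) (F : I -> wt) :
  (forall i, weight_of (F i)) -> weight_of (\sum_(i <- s) F i).
Proof.
by move=> HF; apply: (big_ind weight_of) => //; [exact: weight_of0 | exact: weight_of_add].
Qed.

Lemma coord_neq0 j : y j != 0.
Proof.
apply: contraNneq y_jac => yj; rewrite -(subst_at_id y j) yj.
by rewrite (der0 (derivation_subst y j)).
Qed.

Lemma weight_of_coord j : weight_of (x j).
Proof. by exists (y j); [exact: Wy | exact: coord_neq0]. Qed.

Lemma weight_of_mulz j (m : int) : weight_of (x j *~ m).
Proof.
case: m => m; first exact: weight_of_muln (weight_of_coord j).
rewrite NegzE mulrNz -mulNrz; apply: weight_of_muln.
have -> : - x j = \sum_(l | l != j) x l.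
  by move/eqP: x_sum; rewrite (bigD1 j) //= addr_eq0 => /eqP ->; rewrite opprK.
rewrite -big_filter; apply: weight_of_sum => i; exact: weight_of_coord.
Qed.

Lemma weight_combination c :
  c *~ \det X = \sum_i x (fintype.lift ord0 i) *~ (c *m \adj X) 0 i.
Proof.
have -> : c *~ \det X = c *m \adj X *m X.
  by rewrite -mulmxA mul_adj_mx mul_mx_scalar -scaler_int intz.
apply/rowP => l; rewrite !mxE summxE; apply: eq_bigr => i _.
by rewrite -scaler_int intz !mxE.
Qed.

Lemma weight_multiple c : exists2 s : nat, (0 < s)%N &
  exists m : 'I_d -> int, c *+ s = \sum_i x (fintype.lift ord0 i) *~ m i.
Proof.
(* The determinant may be negative, so its square serves as the positive multiplier. *)
have [s s0 Es] : exists2 s : nat, (0 < s)%N & \det X * \det X = s%:Z.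
  move: weights_det; case: (\det X) => m m0; last by exists (m.+1 * m.+1)%N.
  by exists (m * m)%N => //; rewrite muln_gt0 andbb lt0n.
exists s => //; exists (fun i => (c *~ \det X *m \adj X) 0 i).
by rewrite -[c *+ s]/(c *~ s%:Z) -Es mulrzA weight_combination.
Qed.

(** Some positive multiple s c is an integer combination of the [x j], and those combinations occur
    with both signs because the [x j] sum to zero. Then -c = (s - 1) c + (- s c). *)
Lemma weight_of_opp c : weight_of c -> weight_of (- c).
Proof.
move=> Hc; have [s s0 [m Em]] := weight_multiple c.
have -> : - c = c *+ s.-1 + (- (c *+ s)).
  by rewrite -{2}(prednK s0) mulrS opprD addrCA subrr addr0.
apply: weight_of_add; first exact: weight_of_muln.
rewrite Em -sumrN; apply: weight_of_sum => i.
by rewrite -mulrNz; exact: weight_of_mulz.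
Qed.

End CodimOne.

(** * The invariant part of the Euler field *)

Section EulerField.
Variables (k : fieldType) (n d : nat).
Local Notation P := {mpoly k[n]}.
Local Notation wt := 'rV[int]_d.

Definition euler (f : P) : P := \sum_j 'X_j * f^`M(j).

Lemma derivation_euler : derivation euler.
Proof. by apply: (@derivation_comb k n n (fun j => 'X_j) (fun j => mderiv j)) => j; exact: derivation_mderiv. Qed.

Lemma divergence_euler : divergence euler = n%:R.
Proof.
rewrite (@divergence_comb k n n (fun j => 'X_j) (fun j => mderiv j)) => [|j]; last exact: derivation_mderiv.
rewrite (eq_bigr (fun=> 1)) ?sumr_const ?card_ord // => j _.
rewrite mderivXU eqxx /divergence big1 ?mulr0 ?addr0 // => l _.
by rewrite mderivXU; case: eqP; rewrite (mderiv0, mderivC).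
Qed.

Variable W : wt -> P -> Prop.
Hypothesis gW : grading W.

Lemma gproj_add x : {morph gproj gW x : f g / f + g}.
Proof. by move=> f g; have := gproj_linear gW x 1 f g; rewrite !scale1r. Qed.

Lemma gproj_sub x f g : gproj gW x (f - g) = gproj gW x f - gproj gW x g.
Proof. by rewrite addrC -scaleN1r gproj_linear scaleN1r addrC. Qed.

Lemma gproj_sum x I (s : seq I) (F : I -> P) :
  gproj gW x (\sum_(i <- s) F i) = \sum_(i <- s) gproj gW x (F i).
Proof. exact: (big_morph _ (gproj_add x) (gproj0 gW x)). Qed.

Lemma gproj_shift (h : P -> P) (e x : wt) : linear h ->
  (forall z f, W z f -> W (z + e) (h f)) -> forall f, gproj gW (x + e) (h f) = h (gproj gW x f).
Proof.
move=> lh hW.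
have h0 : h 0 = 0.
  by have := lh (-1) 0 0; rewrite scaler0 addr0 scaleN1r addNr.
apply: (linear_eq gW) => [a f g|a f g|z f Wf].
- by rewrite lh gproj_linear.
- by rewrite gproj_linear lh.
have [zx|/eqP zx] := eqVneq z x; first by rewrite zx in Wf; rewrite !gproj_id //; exact: hW.
rewrite (gproj_other gW zx Wf) h0; apply: (gproj_other gW (y := z + e)); last exact: hW.
by move/addIr.
Qed.

Lemma gproj_mulr x y a g : W y g -> gproj gW (x + y) (a * g) = gproj gW x a * g.
Proof.
move=> Wg; apply: (gproj_shift (h := fun a => a * g)) => [c f h|z f Wf].
  by rewrite mulrDl -scalerAl.
exact: grM.
Qed.

(* E is the weight-zero part of the Euler vector field. *)
Lemma invariant_euler : exists2 E : P -> P, derivation E &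
  forall x f, W x f -> E f = gproj gW x (euler f).
Proof.
have de := derivation_euler.
have [|E lE EE] := weight_operator (gr_lin gW) (gr0 gW) (gr_indep gW) (gr_total gW)
  (T := fun x f => gproj gW x (euler f)).
  by move=> x c f g; rewrite (der_linear de) gproj_linear.
exists E => //; apply: (derivation_of_weights gW) => // x y f g Wf Wg.
rewrite (EE _ _ (grM gW Wf Wg)) (EE _ _ Wf) (EE _ _ Wg) (derM de) gproj_add.
rewrite gproj_mulr //; congr (_ + _).
by rewrite mulrC [x + y]addrC gproj_mulr // mulrC.
Qed.

Variable E : P -> P.
Hypothesis dE : derivation E.
Hypothesis EE : forall x f, W x f -> E f = gproj gW x (euler f).

Lemma euler_weight x f : W x f -> W x (E f).
Proof. by move=> Wf; rewrite (EE Wf); exact: gproj_weight. Qed.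

(** Take the weight-zero part of [der_jacobian] for the Euler field. Since the total weight of [y]
    is zero, each term projects to the corresponding term for [E], and comparison leaves the two
    divergences. *)
Lemma divergence_invariant_euler (x : 'I_n -> wt) (y : 'I_n -> P) :
  (forall (x : 'I_n -> wt) (y : 'I_n -> P),
    (forall j, W (x j) (y j)) -> W (\sum_j x j) (jacobian y)) ->
  (forall j, W (x j) (y j)) -> \sum_j x j = 0 -> jacobian y != 0 ->
  divergence E = n%:R.
Proof.
move=> Wjac Wy s0 J0; apply: (mulIf J0).
have WJ := Wjac _ _ Wy; rewrite s0 in WJ.
have := der_jacobian y dE; rewrite (EE WJ) (der_jacobian y derivation_euler) divergence_euler.
have -> : \sum_i jacobian (subst_at y i (E (y i))) =
    gproj gW 0 (\sum_i jacobian (subst_at y i (euler (y i)))).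
  rewrite gproj_sum; apply: eq_bigr => i _; rewrite (EE (Wy i)).
  rewrite -[in RHS](subrr (x i)).
  apply: esym; apply: (gproj_shift (h := fun f => jacobian (subst_at y i f))).
    exact: der_linear (derivation_subst y i).
  move=> z f Wf; pose x' j := if j == i then z else x j.
  have -> : z - x i = \sum_j x' j.
    rewrite (bigD1 i) //= /x' eqxx; congr (_ + _).
    rewrite (eq_bigr x) => [|j /negbTE -> //].
    by move/eqP: s0; rewrite (bigD1 i) //= addr_eq0 => /eqP ->; rewrite opprK.
  by apply: Wjac => j; rewrite /subst_at /x'; case: eqP.
have nJ : gproj gW 0 (n%:R * jacobian y) = n%:R * jacobian y.
  by rewrite gproj_id // mulr_natl -scaler_nat; exact: gr_scale.
by rewrite gproj_sub nJ => /addrI/oppr_inj ->.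
Qed.

End EulerField.

(** * Tori of codimension one *)

(* The frame consists of the Euler-type field E and the fields D i generating the
   torus. *)
Section Transverse.
Variables (k : fieldType) (d : nat).
Hypothesis char0 : [pchar k] =i pred0.
Local Notation n := d.+1.
Local Notation P := {mpoly k[n]}.
Local Notation wt := 'rV[int]_d.
Variable W : wt -> P -> Prop.
Hypothesis gW : grading W.
Variables (D : 'I_d -> P -> P).
Hypothesis dD : forall i, derivation (D i).
Hypothesis DW : forall i x f, W x f -> D i f = (x 0 i)%:~R *: f.
Hypothesis divD : forall i, divergence (D i) = 0.
Variables (x : 'I_n -> wt) (y : 'I_n -> P).
Hypothesis Wy : forall j, W (x j) (y j).
Hypothesis x_sum : \sum_j x j = 0.
Hypothesis y_jac : jacobian y != 0.
Variable E : P -> P.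
Hypothesis dE : derivation E.
Hypothesis EW : forall x f, W x f -> W x (E f).
Hypothesis divE : divergence E = n%:R.

Definition frame (r : 'I_n) : P -> P :=
  if fintype.unlift ord0 r is Some i then D i else E.

Lemma frame0 : frame ord0 = E. Proof. by rewrite /frame unlift_none. Qed.
Lemma frame_lift i : frame (fintype.lift ord0 i) = D i. Proof. by rewrite /frame liftK. Qed.

Lemma derivation_frame r : derivation (frame r).
Proof. by case: (unliftP ord0 r) => [i|] ->; rewrite ?frame_lift ?frame0. Qed.

Lemma weight_D i c f : W c f -> W c (D i f).
Proof. by move=> Wf; rewrite (DW i Wf); exact: gr_scale. Qed.

Lemma D_comm (F : P -> P) i f : derivation F -> (forall c f, W c f -> W c (F f)) ->
  D i (F f) = F (D i f).
Proof.
move=> dF FW; move: f; apply: (linear_eq gW) => [a f g|a f g|c f Wf].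
- by rewrite (der_linear dF) (der_linear (dD i)).
- by rewrite (der_linear (dD i)) (der_linear dF).
by rewrite (DW i (FW _ _ Wf)) (DW i Wf) (derZ dF).
Qed.

Definition volume : P := \det (\matrix_(r, j) frame r 'X_j).

Lemma weight_frame r c f : W c f -> W c (frame r f).
Proof.
by case: (unliftP ord0 r) => [i|] ->; rewrite ?frame_lift ?frame0; [exact: weight_D | exact: EW].
Qed.

Lemma D_volume i : D i volume = 0.
Proof.
rewrite /volume (der_det_commuting (dD i) derivation_frame) ?divD ?mul0r // => r f.
by apply: D_comm; [exact: derivation_frame | exact: weight_frame].
Qed.

Lemma E_volume : E volume = n%:R * volume.
Proof.
rewrite /volume (der_det_commuting dE derivation_frame) ?divE // => r f.
by case: (unliftP ord0 r) => [i|] ->; rewrite ?frame_lift ?frame0 // D_comm.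
Qed.

Lemma invariant_kernel f : W 0 f <-> forall i, D i f = 0.
Proof.
split=> [Wf i|Df]; first by rewrite (DW i Wf) mxE scale0r.
have [->|f0] := classic (f = 0); first exact: gr0.
have [|i|e We e0] := eigen_weight char0 gW dD DW (c := fun=> 0) (f := f).
- exact/eqP.
- by rewrite Df scale0r.
rewrite (_ : 0 = e) //; apply/rowP => i; apply: (intr_inj char0).
by rewrite /= e0 mxE.
Qed.

(** If the coefficient of [E] is nonzero, pass to a weight component v of the relation with v_0
    nonzero, of weight c. Applying the relation to v_0 gives E v_0 + \sum_i c_i v_i = 0, while the
    divergence of the zero field is E v_0 + n v_0 + \sum_i c_i v_i. Hence n v_0 = 0, a
    contradiction. The relation left among the [D i] is tested on the [y j], whose weight matrix is
    nonsingular. *)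
Lemma frame_dependence (w : 'I_n -> P) :
  (forall f, \sum_r w r * frame r f = 0) -> forall r, w r = 0.
Proof.
move=> wX.
have w0 : w ord0 = 0.
  apply/eqP; apply: contraT => nz.
  have [s us Es] := gproj_support gW (w ord0).
  have [c cs cnz] : exists2 c, c \in s & gproj gW c (w ord0) != 0.
    apply/hasP; apply: contraNT nz => /hasPn h; rewrite Es big_seq big1 // => c /h.
    by rewrite negbK => /eqP.
  pose v r := gproj gW c (w r).
  have vX f : \sum_r v r * frame r f = 0.
    have dv : derivation (fun f => \sum_r v r * frame r f).
      by apply: derivation_comb; exact: derivation_frame.
    apply: (linear_eq gW (A := fun f => \sum_r v r * frame r f) (B := fun=> 0)) => {f}.
    - exact: der_linear dv.
    - by move=> a f g; rewrite scaler0 addr0.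
    move=> e f Wf.
    transitivity (gproj gW (c + e) (\sum_r w r * frame r f)); last by rewrite wX gproj0.
    rewrite gproj_sum.
    by apply: eq_bigr => r _; rewrite gproj_mulr //; exact: weight_frame.
  have Wv r : W c (v r) by exact: gproj_weight.
  have Ev0 : E (v ord0) + \sum_i (c 0 i)%:~R *: v (fintype.lift ord0 i) = 0.
    apply: (mulfI cnz); rewrite mulr0 -[RHS](vX (v ord0)) big_ord_recl frame0 mulrDr.
    congr (_ + _); rewrite mulr_sumr; apply: eq_bigr => i _.
    by rewrite frame_lift (DW i (Wv ord0)) -!scalerAr mulrC.
  have := divergence_comb v derivation_frame.
  have -> : divergence (fun f => \sum_r v r * frame r f) = 0.
    by rewrite /divergence big1 // => j _; rewrite vX mderiv0.
  rewrite big_ord_recl frame0 divE.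
  under eq_bigr do rewrite frame_lift divD mulr0 addr0 (DW _ (Wv _)).
  rewrite addrAC Ev0 add0r => /esym/eqP; rewrite mulf_eq0 (negbTE cnz) /=.
  by rewrite -mpolyC_nat mpolyC_eq0 (negbTE (natr_neq0 char0 _)).
suff wl i : w (fintype.lift ord0 i) = 0 by move=> r; case: (unliftP ord0 r) => [i|] ->.
move: i; apply: (det_unit_kernel (M := \matrix_(i, l) (x (fintype.lift ord0 i) 0 l)%:~R%:MP)).
  have -> : (\matrix_(i, l) (x (fintype.lift ord0 i) 0 l)%:~R%:MP) =
     map_mx (@mpolyC n k \o intr) (\matrix_(i, l) x (fintype.lift ord0 i) 0 l).
    by apply/matrixP => i l; rewrite !mxE.
  rewrite det_map_mx mpolyC_eq0.
  apply: contra (weights_det char0 gW dD DW Wy x_sum y_jac) => /eqP e.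
  by apply/eqP/(intr_inj char0); rewrite /= e.
move=> i; have := wX (y (fintype.lift ord0 i)); rewrite big_ord_recl w0 mul0r add0r.
under eq_bigr do rewrite frame_lift (DW _ (Wy _)) -mul_mpolyC mulrA.
rewrite -mulr_suml => /eqP; rewrite mulf_eq0 (negbTE (coord_neq0 y_jac _)) orbF => /eqP e.
by rewrite -[RHS]e; apply: eq_bigr => l _; rewrite mxE.
Qed.

Lemma volume_neq0 : volume != 0.
Proof.
apply/det0P => -[v v0 vM]; move/eqP: v0; apply; apply/rowP => r; rewrite mxE.
apply: (frame_dependence (w := fun r => v 0 r)) => f.
transitivity (\sum_j (\sum_r v 0 r * frame r 'X_j) * f^`M(j)).
  under eq_bigr do rewrite (der_expand (derivation_frame _) f) mulr_sumr.
  rewrite exchange_big; apply: eq_bigr => j _; rewrite mulr_suml.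
  by apply: eq_bigr => s _; rewrite mulrA.
rewrite big1 // => j _; move/rowP/(_ j): vM; rewrite !mxE => e.
by rewrite (_ : \sum_r _ = 0) ?mul0r // -[RHS]e; apply: eq_bigr => s _; rewrite mxE.
Qed.

Lemma frame_nondeg (b : 'I_n -> P) :
  (forall r, \sum_j b j * frame r 'X_j = 0) -> forall j, b j = 0.
Proof.
move=> bX; apply: (det_unit_kernel volume_neq0) => r; rewrite -[RHS](bX r).
by apply: eq_bigr => j _; rewrite mxE.
Qed.

(** The two differentials agree on every field of the frame: both vanish on the [D i], and on [E]
    both give n u E f, where u is [volume]. *)
Lemma invariant_differential f j : W 0 f ->
  n%:R * volume * f^`M(j) = E f * volume^`M(j).
Proof.
move=> Wf; apply/eqP; rewrite -subr_eq0; apply/eqP; move: j.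
apply: frame_nondeg => r.
transitivity (n%:R * volume * frame r f - E f * frame r volume).
  rewrite (der_expand (derivation_frame r) f) (der_expand (derivation_frame r) volume).
  by rewrite !mulr_sumr -sumrB; apply: eq_bigr => j _; ring.
case: (unliftP ord0 r) => [i|] ->; rewrite ?frame_lift ?frame0.
  by rewrite D_volume (proj1 (invariant_kernel f) Wf) !mulr0 subrr.
by rewrite E_volume mulrC subrr.
Qed.

End Transverse.

(** * The ring of invariants is k[z] *)

(* Recall that msize is the degree plus one, and 0 for the zero polynomial. *)
Section EulerDegree.
Variables (k : fieldType) (n : nat).
Hypothesis char0 : [pchar k] =i pred0.
Local Notation P := {mpoly k[n]}.

Lemma msize_leP (f : P) K : (forall m, f@_m != 0 -> (mdeg m < K)%N) -> (msize f <= K)%N.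
Proof.
by move=> fK; rewrite msizeE; apply/bigmax_leqP_seq => m; rewrite mcoeff_msupp => nz _; exact: fK.
Qed.

Lemma mcoeff_euler (f : P) m : (euler f)@_m = (mdeg m)%:R * f@_m.
Proof.
have de := derivation_euler k n.
elim/mpolyind: f m => [|c e f _ _ IH] m; first by rewrite (der0 de) !mcoeff0 mulr0.
rewrite (der_linear de) !mcoeffD !mcoeffZ IH mulrDr; congr (_ + _).
have -> : euler 'X_[e] = (mdeg e)%:R *: 'X_[e] :> P.
  rewrite /euler mdegE natr_sum scaler_suml; apply: eq_bigr => j _.
  rewrite mderivX -scalerAr -mpolyXD.
  have [e0|e0] := posnP (e j); first by rewrite e0 !scale0r.
  by rewrite addmC submK //; apply/mnm_lepP => l; rewrite mnmE; case: eqP => // <-.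
rewrite mcoeffZ mcoeffX; have [->|em] := eqVneq e m; last by rewrite !mulr0.
by rewrite !mulr1 mulrC.
Qed.

Lemma msize_euler (f : P) : (msize (euler f) <= msize f)%N.
Proof.
apply: msize_leP => m; rewrite mcoeff_euler => nz; apply: msize_mdeg_lt.
by rewrite mcoeff_msupp; apply: contraNneq nz => ->; rewrite mulr0.
Qed.

Lemma msize_euler_sub (f : P) N : (msize f <= N.+1)%N -> (msize (euler f - N%:R *: f) <= N)%N.
Proof.
move=> fN; apply: msize_leP => m; rewrite mcoeffB mcoeffZ mcoeff_euler -mulrBl => nz.
have mf : m \in msupp f.
  by rewrite mcoeff_msupp; apply: contraNneq nz => ->; rewrite mulr0.
have := leq_trans (msize_mdeg_lt mf) fN; rewrite ltnS leq_eqVlt => /orP[/eqP e|//].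
by move: nz; rewrite e subrr mul0r eqxx.
Qed.

Lemma msizeM_leq (f g : P) : (msize (f * g) <= (msize f + msize g).-1)%N.
Proof.
have [->|f0] := eqVneq f 0; first by rewrite mul0r msize0.
have [->|g0] := eqVneq g 0; first by rewrite mulr0 msize0.
by rewrite msizeM.
Qed.

Lemma msizeB_le (f g : P) K : (msize f <= K)%N -> (msize g <= K)%N -> (msize (f - g) <= K)%N.
Proof.
move=> fK gK; apply: (leq_trans (msizeD_le _ _)); rewrite geq_max fK.
by rewrite msizeN.
Qed.

End EulerDegree.

Lemma nat_min (Q : nat -> Prop) : (exists i, Q i) -> exists i, Q i /\ forall j, Q j -> (i <= j)%N.
Proof.
case=> i; elim/ltn_ind: i => i IH Qi.
have [[j [ji Qj]]|no] := classic (exists j, (j < i)%N /\ Q j); first exact: IH Qj.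
by exists i; split=> // j Qj; rewrite leqNgt; apply/negP => ji; apply: no; exists j.
Qed.

(* By rel, the differential of an invariant f is proportional to du. Comparing
   top-degree forms in rel contracted with the Euler field, E multiplies the top
   form of an invariant f by kappa * deg f; hence E is diagonalisable on the ring R
   of invariants, with one-dimensional eigenspaces indexed by degrees. An
   eigenvector z of least positive degree generates R: any other eigenvector f has
   a power equal to z^m u^j up to a scalar, so z divides f. *)
Section Invariants.
Variables (k : fieldType) (n : nat).
Hypothesis char0 : [pchar k] =i pred0.
Local Notation P := {mpoly k[n]}.
Variables (R : P -> Prop) (E : P -> P) (u : P) (nu : k).
Hypothesis R_lin : forall c f g, R f -> R g -> R (c *: f + g).
Hypothesis RM : forall f g, R f -> R g -> R (f * g).
Hypothesis R1 : R 1.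
Hypothesis R_div : forall f g, f != 0 -> R f -> R (f * g) -> R g.
Hypothesis R_E : forall f, R f -> R (E f).
Hypothesis dE : derivation E.
Hypothesis nu0 : nu != 0.
Hypothesis Ru : R u.
Hypothesis u0 : u != 0.
Hypothesis Eu : E u = nu *: u.
Hypothesis rel : forall f j, R f -> (nu *: u) * f^`M(j) = E f * u^`M(j).

Let du := (msize u).-1.
(** Normalised so that the rule [kappa] times degree assigns to [u], of degree [du], its actual
    eigenvalue [nu]. *)
Let kappa := nu / du%:R.

Lemma msize_u : msize u = du.+1.
Proof. by rewrite /du prednK // lt0n msize_poly_eq0. Qed.

Lemma du_gt0 : (0 < du)%N.
Proof.
rewrite lt0n; apply: contraNneq u0 => d0.
have : msize u == 1%N by rewrite msize_u d0.
case/msize_poly1P => c _ uc; move: Eu; rewrite uc (derC dE) => /esym/eqP.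
by rewrite scaler_eq0 (negbTE nu0).
Qed.

Lemma R0 : R 0.
Proof. by have := R_lin (-1) R1 R1; rewrite scaleN1r addNr. Qed.
Lemma R_scale c f : R f -> R (c *: f).
Proof. by move=> Rf; rewrite -[_ *: _]addr0; exact: R_lin R0. Qed.
Lemma rel_euler f : R f -> (nu *: u) * euler f = E f * euler u.
Proof.
move=> Rf; rewrite /euler !mulr_sumr; apply: eq_bigr => j _.
by rewrite mulrCA rel // mulrCA.
Qed.

Lemma euler_u_neq0 : euler u != 0 /\ msize (euler u) = du.+1.
Proof.
have le : (msize (euler u) <= du.+1)%N by rewrite -msize_u; exact: msize_euler.
suff gt : (du < msize (euler u))%N.
  split; last by apply/eqP; rewrite eqn_leq le.
  by rewrite -msize_poly_eq0 -lt0n (leq_ltn_trans _ gt).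
rewrite ltnNge; apply/negP => le'.
have : (msize (du%:R *: u) <= du)%N.
  have -> : du%:R *: u = euler u - (euler u - du%:R *: u) by rewrite subKr.
  by apply: msizeB_le => //; apply: msize_euler_sub; rewrite msize_u.
by rewrite msizeZ ?msize_u ?ltnn // natr_neq0 // du_gt0.
Qed.

Lemma msize_E f : R f -> (msize (E f) <= msize f)%N.
Proof.
move=> Rf; have [->|Ef0] := eqVneq (E f) 0; first by rewrite msize0.
have [eu0 eus] := euler_u_neq0.
have := rel_euler Rf => re.
have [ef0|ef0] := eqVneq (euler f) 0.
  move/eqP: re; rewrite ef0 mulr0 eq_sym mulf_eq0 (negbTE Ef0) (negbTE eu0) //.
have := congr1 (fun h : P => msize h) re; rewrite !msizeM // ?scaler_eq0 ?negb_or ?nu0 //.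
rewrite msizeZ // msize_u eus addSn addnS /= addnC => /addIn <-.
exact: msize_euler.
Qed.

Lemma msize_E_sub f N : R f -> (msize f <= N.+1)%N ->
  (msize (E f - (kappa * N%:R) *: f) <= N)%N.
Proof.
move=> Rf fN; set s := _ - _.
have [->|s0] := eqVneq s 0; first by rewrite msize0.
have dk : du%:R != 0 :> k by rewrite natr_neq0 // du_gt0.
(* These are the lower-degree errors in replacing the Euler field by multiplication by the degree.
   Substituted into [rel_euler], they express a multiple of u s through terms of small degree. *)
pose rho := euler f - N%:R *: f; pose mu := euler u - du%:R *: u.
have rN : (msize rho <= N)%N by exact: msize_euler_sub.
have mN : (msize mu <= du)%N by apply: msize_euler_sub; rewrite msize_u.
have us : (du%:R *: u) * s = (nu *: u) * rho - E f * mu.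
  have kd : nu%:MP = du%:R%:MP * kappa%:MP :> P by rewrite -mpolyCM mulrC divfK.
  rewrite /rho /mu /s [E f * _]mulrBr -rel_euler // -!mul_mpolyC mpolyCM kd; ring.
have : (msize ((du%:R *: u) * s) <= N + du)%N.
  rewrite us; apply: msizeB_le.
    rewrite (leq_trans (msizeM_leq _ _)) // msizeZ // msize_u addSn /= addnC.
    by rewrite leq_add2r.
  rewrite (leq_trans (msizeM_leq _ _)) //.
  have : (msize (E f) + msize mu <= (N + du).+1)%N.
    by rewrite -addSn leq_add // (leq_trans (msize_E Rf) fN).
  by case: (_ + msize mu)%N.
rewrite msizeM // ?scaler_eq0 ?negb_or ?dk // msizeZ // msize_u addSn /=.
by rewrite addnC leq_add2r.
Qed.

Definition eig (i : nat) (f : P) : Prop := R f /\ E f = (kappa * i%:R) *: f.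


Lemma eig_scale i c f : eig i f -> eig i (c *: f).
Proof.
by case=> Rf Ef; split; [exact: R_scale | rewrite (derZ dE) Ef !scalerA mulrC].
Qed.

Lemma eig_mul i j f g : eig i f -> eig j g -> eig (i + j) (f * g).
Proof.
move=> [Rf Ef] [Rg Eg]; split; first exact: RM.
by rewrite (derM dE) Ef Eg natrD mulrDr scalerDl -scalerAl -scalerAr.
Qed.

Lemma eig1 : eig 0 1.
Proof. by split; [exact: R1 | rewrite (der1 dE) mulr0 scale0r]. Qed.

Lemma eig_exp i f m : eig i f -> eig (i * m) (f ^+ m).
Proof.
move=> Hf; elim: m => [|m IH]; first by rewrite muln0 expr0; exact: eig1.
by rewrite mulnS exprS; exact: eig_mul.
Qed.

Lemma eig_u : eig du u.
Proof. by split; [exact: Ru | rewrite Eu /kappa divfK // natr_neq0 // du_gt0]. Qed.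

Lemma kappa_neq0 : kappa != 0.
Proof. by rewrite mulf_neq0 // invr_eq0 natr_neq0 // du_gt0. Qed.

Lemma eig_line i f g : eig i f -> eig i g -> g != 0 -> exists c, f = c *: g.
Proof.
move=> [Rf Ef] [Rg Eg] g0; apply: (proportional char0) => // j.
have nz : nu *: u != 0 by rewrite scaler_eq0 negb_or nu0.
apply: (mulfI nz); rewrite mulrCA (rel _ Rg) [RHS]mulrCA (rel _ Rf) Ef Eg.
by rewrite -!mul_mpolyC; ring.
Qed.

Lemma eig_solve N s : weight_sum eig (fun i => (i <= N)%N) s ->
  exists2 h, weight_sum eig (fun i => (i <= N)%N) h & E h - (kappa * N.+1%:R) *: h = s.
Proof.
move=> [t [tW ->]]; elim: t tW => [|g t IH] tW.
  by exists 0; [exact: weight_sum0 | rewrite big_nil (der0 dE) scaler0 subr0].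
have [h ht|h Wh Eh] := IH; first by apply: tW; rewrite inE ht orbT.
have [|i iN Hg] := tW g; first by rewrite inE eqxx.
pose c := kappa * i%:R - kappa * N.+1%:R.
have c0 : c != 0.
  rewrite /c -mulrBr mulf_neq0 ?kappa_neq0 // subr_eq0; apply/eqP => /(natr_inj char0) e.
  by move: iN; rewrite e ltnn.
exists (c^-1 *: g + h).
  by apply: weight_sum_add => //; apply: (weight_sum1 (x := i)) => //; exact: eig_scale.
have [_ Eg] := eig_scale c^-1 Hg.
rewrite (der_add dE) Eg big_cons scalerDr opprD addrACA Eh -scalerBl -/c; congr (_ + _).
by rewrite scalerA mulfV // scale1r.
Qed.

(** For [f] of degree at most N + 1, E - kappa (N + 1) sends [f] to lower degree, where by induction
    the image splits into eigenvectors of index at most N. On these the operator is invertible; a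
    preimage h there makes f - h an eigenvector of index N + 1. *)
Lemma eig_total f : R f -> weight_sum eig (fun=> True) f.
Proof.
suff Q N : forall f, R f -> (msize f <= N.+1)%N -> weight_sum eig (fun i => (i <= N)%N) f.
  by move=> Rf; apply: (weight_sum_mono (Q := fun i => (i <= msize f)%N)) => //; exact: Q.
elim: N => [|N IH] {}f Rf fN.
  apply: (weight_sum1 (x := 0%N)) => //; split=> //.
  by rewrite (msize1_polyC fN) (derC dE) mulr0 scale0r.
have Rs : R (E f - (kappa * N.+1%:R) *: f).
  by rewrite addrC -scaleNr; apply: R_lin => //; exact: R_E.
have [h Wh Eh] := eig_solve (IH _ Rs (msize_E_sub Rf fN)).
have Rh : R h.
  case: Wh => t [tW ->]; rewrite big_seq; apply: (big_ind R); first exact: R0.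
    by move=> a b Ra; rewrite -[a]scale1r; exact: R_lin.
  by move=> g /tW[i _ []].
rewrite -(subrK h f); apply: weight_sum_add; last first.
  by apply: weight_sum_mono Wh => i /leqW.
apply: (weight_sum1 (x := N.+1)) => //; split.
  by rewrite addrC -scaleN1r; exact: R_lin.
rewrite (derB dE) scalerBr; move: (E f) (E h) (_ *: f) (_ *: h) Eh => a b a' b' Eh.
by apply/eqP; rewrite subr_eq -addrA [- b' + b]addrC Eh addrCA subrr addr0.
Qed.

Lemma invariants_polynomial : exists z g, [/\ R z, z != 0, g != 0, E z = g *: z
  & forall f, R f -> exists q : {poly k}, f = (map_poly (@mpolyC n k) q).[z]].
Proof.
have [i0 [[i0_gt0 [z Hz z0]] i0min]] :
    exists i, ((0 < i)%N /\ exists2 z, eig i z & z != 0) /\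
      forall j, ((0 < j)%N /\ exists2 z, eig j z & z != 0) -> (i <= j)%N.
  by apply: nat_min; exists du; split; [exact: du_gt0 | exists u; [exact: eig_u|]].
have [Rz Ez] := Hz.
exists z, (kappa * i0%:R); split=> //.
  by rewrite mulf_neq0 ?kappa_neq0 // natr_neq0.
have power i f : eig i f -> f != 0 -> exists m c, f = c *: z ^+ m.
  elim/ltn_ind: i f => i IH f Hf f0.
  have [i_0|i_gt0] := posnP i.
    rewrite i_0 in Hf; have [c Ec] := eig_line Hf eig1 (oner_neq0 _).
    by exists 0%N, c; rewrite expr0.
  have ile : (i0 <= i)%N by apply: i0min; split=> //; exists f.
  (* f^du and z^du u^(i - i0) both have index i du, hence are proportional, so z^du divides f^du. *)
  have Hfd := eig_exp du Hf.
  have Hzu := eig_mul (eig_exp du Hz) (eig_exp (i - i0) eig_u).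
  have ei : (i * du = i0 * du + du * (i - i0))%N by rewrite [(du * _)%N]mulnC -mulnDl subnKC.
  rewrite ei in Hfd.
  have [|c Ec] := eig_line Hfd Hzu; first by rewrite mulf_neq0 // expf_neq0.
  have [|q Eq] := @dvd_of_dvd_pow k n char0 du z f (c *: u ^+ (i - i0)) du_gt0 z0.
    by rewrite Ec scalerAr.
  have q0 : q != 0 by apply: contraNneq f0; rewrite Eq => ->; rewrite mulr0.
  have Hq : eig (i - i0) q.
    have [Rf Ef] := Hf; split; first by apply: (R_div z0 Rz); rewrite -Eq.
    have e : (kappa * i0%:R) *: (z * q) + z * E q = (kappa * i%:R) *: (z * q).
      by rewrite scalerAl -Ez -(derM dE) -Eq Ef.
    apply: (mulfI z0); rewrite -scalerAr natrB // mulrBr scalerBl -e.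
    by rewrite addrC addKr.
  have [|m [e Eqm]] := IH _ _ _ Hq q0; first by rewrite ltn_subrL i0_gt0.
  by exists m.+1, e; rewrite Eq Eqm exprS scalerAr.
move=> f /eig_total[s [sW ->]]; elim: s sW => [|g s IH] sW.
  by exists 0; rewrite big_nil rmorph0 horner0.
have [h hs|q Eq] := IH; first by apply: sW; rewrite inE hs orbT.
have [|i _ Hg] := sW g; first by rewrite inE eqxx.
have [g0|g0] := eqVneq g 0; first by exists q; rewrite big_cons g0 add0r.
have [m [c Ec]] := power _ _ Hg g0.
exists (c *: 'X^m + q); rewrite big_cons rmorphD /= hornerD -Eq; congr (_ + _).
by rewrite map_polyZ /= map_polyXn hornerZ hornerXn Ec mul_mpolyC.
Qed.

End Invariants.

Section PolyConstants.
Variable k : fieldType.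
Hypothesis char0 : [pchar k] =i pred0.

Lemma deriv0_const (q : {poly k}) : q^`() = 0 -> q = (q`_0)%:P.
Proof.
move=> dq; apply/polyP => -[|i]; rewrite coefC //=.
have := congr1 (fun p : {poly k} => p`_i) dq; rewrite coef_deriv coef0 => /eqP.
by rewrite -mulr_natr mulf_eq0 (negbTE (natr_neq0 char0 _)) // orbF => /eqP.
Qed.

Definition const_poly (p : {poly k}) : bool := (size p <= 1)%N.

(** The right-hand side has degree at most that of [r]. *)
Lemma log_derivative_const (w r : {poly k}) (g : k) : r != 0 ->
  w * r = g *: ('X * r^`()) -> const_poly w.
Proof.
move=> r0 wr; have [->|w0] := eqVneq w 0; first by rewrite /const_poly size_poly0.
have : (size (w * r)%R <= size r)%N.
  rewrite wr (leq_trans (size_scale_leq _ _)) // mulrC.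
  by rewrite (leq_trans (size_polyMleq _ _)) // size_polyX addn2 /= lt_size_deriv.
have : (0 < size r)%N by rewrite size_poly_gt0.
by rewrite /const_poly size_mul //; case: (size r) => // m _; rewrite addnS /= -add1n leq_add2r.
Qed.

Lemma const_add (p q : {poly k}) : const_poly p -> const_poly q -> const_poly (p + q).
Proof. by move=> sp sq; rewrite /const_poly (leq_trans (size_polyD _ _)) // geq_max; apply/andP. Qed.

Lemma const_sub (p q : {poly k}) : const_poly p -> const_poly q -> const_poly (p - q).
Proof. by move=> sp sq; apply: const_add; rewrite // /const_poly size_polyN. Qed.

End PolyConstants.

(** * Weight spaces are free modules over k[z] *)

Section ModuleStructure.
Variables (k : fieldType) (d : nat).
Hypothesis char0 : [pchar k] =i pred0.
Local Notation n := d.+1.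
Local Notation P := {mpoly k[n]}.
Local Notation wt := 'rV[int]_d.
Variable W : wt -> P -> Prop.
Hypothesis gW : grading W.
Variable E : P -> P.
Hypothesis dE : derivation E.
Hypothesis EW : forall x f, W x f -> W x (E f).
Variables (z : P) (g : k).
Hypothesis Wz : W 0 z.
Hypothesis z0 : z != 0.
Hypothesis g0 : g != 0.
Hypothesis Ez : E z = g *: z.
Hypothesis W0_poly : forall f, W 0 f -> exists q : {poly k}, f = (map_poly (@mpolyC n k) q).[z].
Hypothesis W_opp : forall c, weight_of W c -> weight_of W (- c).

Definition zpoly (q : {poly k}) : P := (map_poly (@mpolyC n k) q).[z].

Lemma zpolyD p q : zpoly (p + q) = zpoly p + zpoly q.
Proof. by rewrite /zpoly rmorphD hornerD. Qed.
Lemma zpolyB p q : zpoly (p - q) = zpoly p - zpoly q.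
Proof. by rewrite /zpoly rmorphB /= hornerD hornerN. Qed.
Lemma zpolyM p q : zpoly (p * q) = zpoly p * zpoly q.
Proof. by rewrite /zpoly rmorphM hornerM. Qed.
Lemma zpolyC c : zpoly c%:P = c%:MP.
Proof. by rewrite /zpoly map_polyC hornerC. Qed.
Lemma zpolyX : zpoly 'X = z.
Proof. by rewrite /zpoly map_polyX hornerX. Qed.
Lemma zpoly0 : zpoly 0 = 0.
Proof. by rewrite /zpoly rmorph0 horner0. Qed.
Lemma zpolyZ c q : zpoly (c *: q) = c *: zpoly q.
Proof. by rewrite -mul_polyC zpolyM zpolyC mul_mpolyC. Qed.
Lemma zpoly_sum I (s : seq I) (F : I -> {poly k}) :
  zpoly (\sum_(i <- s) F i) = \sum_(i <- s) zpoly (F i).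
Proof. exact: (big_morph _ zpolyD zpoly0). Qed.

Lemma zpoly_weight q : W 0 (zpoly q).
Proof.
elim/poly_ind: q => [|q c Wq]; first by rewrite zpoly0; exact: gr0.
rewrite zpolyD zpolyM zpolyX zpolyC; apply: (gr_add gW).
  by rewrite -[0]addr0; exact: grM.
rewrite -[c%:MP]mulr1 mul_mpolyC; apply: (gr_scale gW); exact: gr1.
Qed.

Lemma E_zpoly q : E (zpoly q) = zpoly (g *: ('X * q^`())).
Proof. by rewrite (der_horner dE) Ez zpolyZ zpolyM zpolyX -scalerAr mulrC. Qed.

(** Applying [E] to q(z) = 0 gives z q'(z) = 0, a relation of lower degree; so z is
    transcendental. *)
Lemma zpoly_eq0 q : zpoly q = 0 -> q = 0.
Proof.
have [m] := ubnP (size q); elim: m q => // m IH q sq e.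
have [//|q0] := eqVneq q 0.
have dq : q^`() = 0.
  apply: IH; first exact: leq_trans (lt_size_deriv q0) _.
  have := E_zpoly q; rewrite e (der0 dE) zpolyZ zpolyM zpolyX => /esym/eqP.
  by rewrite scaler_eq0 (negbTE g0) mulf_eq0 (negbTE z0) => /eqP.
move: e; rewrite (deriv0_const char0 dq) zpolyC => /eqP.
by rewrite mpolyC_eq0 => /eqP->.
Qed.

Lemma zpoly_inj p q : zpoly p = zpoly q -> p = q.
Proof.
by move=> e; apply/eqP; rewrite -subr_eq0; apply/eqP/zpoly_eq0; rewrite zpolyB e subrr.
Qed.

Definition generator (c : wt) (f : P) : Prop :=
  [/\ W c f, f != 0 & forall f', W c f' -> exists q, f' = zpoly q * f].

(** Take [f] nonzero of least degree. Multiplying by a vector of weight -c lands in k[z], so f'/f is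
    a fraction p/q of polynomials in z, taken in lowest terms. Bezout's identity a q + b p = 1 gives
    f = q (a f + b f'), and minimality of the degree forces q to be constant. *)
Lemma exists_generator c : weight_of W c -> exists f, generator c f.
Proof.
move=> Hc; have [_ [[f [Wf f0 <-]] fmin]] :
    exists i, (exists f, [/\ W c f, f != 0 & msize f = i]) /\
      forall j, (exists f, [/\ W c f, f != 0 & msize f = j]) -> (i <= j)%N.
  apply: nat_min; case: Hc => f Wf f0; by exists (msize f), f.
exists f; split=> // f' Wf'.
have [->|f'0] := eqVneq f' 0; first by exists 0; rewrite zpoly0 mul0r.
have [h Wh h0] := W_opp Hc.
have hW e : W c e -> W 0 (e * h) by move=> We; rewrite -(subrr c); exact: grM.
have [q Eq] := W0_poly (hW _ Wf); have [p Ep] := W0_poly (hW _ Wf').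
rewrite -/(zpoly _) in Eq; rewrite -/(zpoly _) in Ep.
have q0 : q != 0.
  by apply: contraNneq (mulf_neq0 f0 h0) => q0; rewrite Eq q0 zpoly0.
have qp : zpoly q * f' = zpoly p * f by rewrite -Eq -Ep; ring.
pose e := gcdp q p.
have e0 : e != 0 by rewrite gcdp_eq0 negb_and q0.
have ze0 : zpoly e != 0 by apply: contra e0 => /eqP/zpoly_eq0 ->.
have Eq1 : q = q %/ e * e by rewrite divpK // dvdp_gcdl.
have Ep1 : p = p %/ e * e by rewrite divpK // dvdp_gcdr.
have qp1 : zpoly (q %/ e) * f' = zpoly (p %/ e) * f.
  apply: (mulIf ze0); rewrite mulrAC -zpolyM -Eq1 qp mulrAC.
  by rewrite -[in RHS]zpolyM -Ep1.
have cop : coprimep (q %/ e) (p %/ e).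
  by apply: coprimep_div_gcd; rewrite q0.
have /Bezout_eq1_coprimepP[[a b] /= ab] := cop.
have Ef : f = zpoly (q %/ e) * (zpoly a * f + zpoly b * f').
  have z1 : 1 = zpoly 1 by rewrite -[1 in RHS]/(1%:P) zpolyC mpolyC1.
  rewrite -{1}[f]mul1r z1 -ab zpolyD !zpolyM mulrDl.
  rewrite mulrDr [X in _ = _ + X]mulrCA qp1; ring.
set f1 := _ + _ in Ef.
have f10 : f1 != 0 by apply: contraNneq f0 => f10; rewrite Ef f10 mulr0.
have Wf1 : W c f1.
  by apply: (gr_add gW); rewrite -[c]add0r; apply: (grM gW) => //; exact: zpoly_weight.
have q10 : zpoly (q %/ e) != 0 by apply: contraNneq f0 => q10; rewrite Ef q10 mul0r.
have : (msize (zpoly (q %/ e)) <= 1)%N.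
  have : (msize f <= msize f1)%N by apply: fmin; exists f1.
  have : (0 < msize f1)%N by rewrite lt0n msize_poly_eq0.
  rewrite Ef msizeM //; case: (msize f1) => // m _.
  by rewrite addnS /= -[X in (_ <= X)%N]add1n leq_add2r.
move=> /msize1_polyC; set r := _@_0 => Er.
have r0 : r != 0 by apply: contraNneq q10 => r0; rewrite Er r0.
exists (r^-1 *: (p %/ e)); apply: (mulfI q10).
by rewrite qp1 zpolyZ -scalerAl -scalerAr Er mul_mpolyC scalerA mulVf // scale1r.
Qed.

Lemma generator_E c f : generator c f -> exists a, E f = zpoly a * f.
Proof. by case=> Wf _ fW; apply: fW; exact: EW. Qed.

(** Writing fa fb = r(z) fe and taking logarithmic derivatives, qa + qb - qe equals g z r'/r, which
    can be a polynomial only if it is constant. *)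
Lemma generator_log a b e fa fb fe qa qb qe :
  generator a fa -> generator b fb -> generator e fe -> e = a + b ->
  E fa = zpoly qa * fa -> E fb = zpoly qb * fb -> E fe = zpoly qe * fe ->
  const_poly (qa + qb - qe).
Proof.
move=> [Wa a0 _] [Wb b0 _] [We e0 eW] eab Ea Eb Ee.
have [|r Er] := eW (fa * fb); first by rewrite eab; exact: grM.
have r0 : r != 0.
  by apply: contraNneq (mulf_neq0 a0 b0) => r0; rewrite Er r0 zpoly0 mul0r.
apply: (@log_derivative_const _ _ r g) => //; apply: zpoly_inj; apply: (mulIf e0).
rewrite -E_zpoly zpolyM zpolyB zpolyD -mulrA -Er.
have : E (fa * fb) = E (zpoly r * fe) by rewrite Er.
rewrite (derM dE) Ea Eb (derM dE) Ee => h.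
have -> : E (zpoly r) * fe = zpoly qa * fa * fb + fa * (zpoly qb * fb) - zpoly qe * (zpoly r * fe).
  by rewrite h; ring.
by rewrite -Er; ring.
Qed.


(* Modulo constants, the logarithmic E-derivative of a generator of the c-weight
   space is an additive function of c. *)
Definition log_weight (c : wt) (a : {poly k}) : Prop :=
  exists2 f, generator c f & E f = zpoly a * f.

Lemma exists_log_weight c : weight_of W c -> exists a, log_weight c a.
Proof.
by move=> /exists_generator[f gf]; have [a Ea] := generator_E gf; exists a, f.
Qed.

Lemma log_weight_add a b qa qb qe : log_weight a qa -> log_weight b qb ->
  log_weight (a + b) qe -> const_poly (qa + qb - qe).
Proof.
move=> [fa ga Ea] [fb gb Eb] [fe ge Ee].
by apply: (generator_log ga gb ge).
Qed.

Variables (dx : 'I_d -> wt).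
Hypothesis dx_weight : forall i, weight_of W (dx i).
Hypothesis dx_det : \det (\matrix_(i, l) dx i 0 l) != 0.
Hypothesis dx_mult : forall c, exists2 s : nat, (0 < s)%N &
  exists m : 'I_d -> int, c *+ s = \sum_i dx i *~ m i.

Section Correction.
Variable cc : 'I_d -> {poly k}.
(** The logarithmic derivative of a vector of weight [c] along E - \sum_j cc_j(z) D_j, when [a] is
    the one along [E]. *)
Definition corrected (c : wt) (a : {poly k}) := a - \sum_j (c 0 j)%:~R *: cc j.
Definition good (c : wt) := weight_of W c /\ forall a, log_weight c a -> const_poly (corrected c a).

Lemma corrected_add a b qa qb qe : log_weight a qa -> log_weight b qb ->
  log_weight (a + b) qe ->
  const_poly (corrected a qa + corrected b qb - corrected (a + b) qe).
Proof.
move=> la lb le; have := log_weight_add la lb le.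
congr const_poly; rewrite /corrected.
have -> : \sum_j ((a + b) 0 j)%:~R *: cc j =
    \sum_j (a 0 j)%:~R *: cc j + \sum_j (b 0 j)%:~R *: cc j.
  by rewrite -big_split; apply: eq_bigr => j _; rewrite mxE rmorphD /= scalerDl.
ring.
Qed.

Lemma good0 : good 0.
Proof.
split=> [|a la]; first by exact: weight_of0.
have := @corrected_add 0 0 a a a la la; rewrite addr0 => /(_ la).
by rewrite addrK.
Qed.

Lemma good_add a b : good a -> good b -> good (a + b).
Proof.
move=> [Ha ga] [Hb gb]; split=> [|qe le]; first exact: weight_of_add.
have [[qa la] [qb lb]] := (exists_log_weight Ha, exists_log_weight Hb).
have := const_sub (const_add (ga _ la) (gb _ lb)) (corrected_add la lb le).
by rewrite subKr.
Qed.

Lemma good_opp a : good a -> good (- a).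
Proof.
move=> [Ha ga]; split=> [|qb lb]; first exact: W_opp.
have [qa la] := exists_log_weight Ha.
have [q0 l0] := exists_log_weight (weight_of0 gW).
have := @corrected_add a (- a) qa qb q0 la lb; rewrite subrr => /(_ l0) h.
have := const_add h (const_sub (proj2 good0 _ l0) (ga _ la)).
by congr const_poly; ring.
Qed.

Lemma good_mulz a (m : int) : good a -> good (a *~ m).
Proof.
move=> ga; have gn j : good (a *+ j).
  elim: j => [|j IH]; first by rewrite mulr0n; exact: good0.
  by rewrite mulrS; exact: good_add.
case: m => m; first exact: gn.
by rewrite NegzE mulrNz; apply: good_opp; exact: gn.
Qed.

(** [corrected] is additive in the weight modulo constants, so [s] times its value at [c] is
    constant, and [s] is invertible in [k]. *)
Lemma good_torsion c s : (0 < s)%N -> weight_of W c -> good (c *+ s) -> good c.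
Proof.
move=> s0 Hc [_ gs]; split=> // a la.
have mult j b : log_weight (c *+ j) b -> const_poly (corrected (c *+ j) b - (corrected c a) *+ j).
  elim: j b => [|j IH] b lb.
    by rewrite !mulr0n subr0; apply: (proj2 good0); rewrite mulr0n in lb.
  have [e le] := exists_log_weight (weight_of_muln gW j Hc).
  rewrite mulrS in lb *; have h := corrected_add la le lb.
  have := const_sub (IH _ le) h; congr const_poly.
  rewrite [corrected c a *+ j.+1]mulrS; ring.
have [b lb] := exists_log_weight (weight_of_muln gW s Hc).
have := const_sub (gs _ lb) (mult _ _ lb); rewrite subKr -scaler_nat /const_poly size_scale //.
exact: natr_neq0.
Qed.

Lemma all_good : (forall i, good (dx i)) -> forall c, weight_of W c -> good c.
Proof.
move=> gx c Hc; have [s s0 [m Em]] := dx_mult c.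
apply: (good_torsion s0 Hc); rewrite Em.
apply: (big_ind good) => // [|a b|i _]; [exact: good0 | exact: good_add | exact: good_mulz].
Qed.

End Correction.

(** The [cc j] solve the linear system that makes the corrected derivatives [a i] vanish at the
    independent weights [dx i]. Additivity modulo constants extends this to the lattice of the
    [dx i], and [good_torsion] to all weights. *)
Lemma exists_correction : exists cc : 'I_d -> {poly k}, forall c a, log_weight c a ->
  const_poly (corrected cc c a).
Proof.
have [a la] := fin_all_exists (fun i => exists_log_weight (dx_weight i)).
pose Y := map_mx (intr : int -> k) (\matrix_(i, l) dx i 0 l).
have Y0 : Y \in unitmx.
  rewrite unitmxE unitfE det_map_mx; apply: contra dx_det => /eqP e.
  by apply/eqP/(intr_inj char0); rewrite /= e.
pose cc j := \sum_i invmx Y j i *: a i.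
exists cc => c b lb; suff gx : forall i, good cc (dx i).
  have [f [Wf f0 _] _] := lb.
  by apply: (proj2 (all_good gx _)) => //; exists f.
have E0 i : corrected cc (dx i) (a i) = 0.
  rewrite /corrected; apply/eqP; rewrite subr_eq0 eq_sym; apply/eqP.
  under eq_bigr do rewrite /cc scaler_sumr.
  rewrite exchange_big (bigD1 i) //= [X in _ + X]big1 ?addr0 => [|l li].
    under eq_bigr do rewrite scalerA.
    rewrite -scaler_suml (_ : \sum_j _ = 1) ?scale1r //.
    transitivity ((Y *m invmx Y) i i); last by rewrite mulmxV // mxE eqxx.
    by rewrite mxE; apply: eq_bigr => j _; rewrite !mxE.
  under eq_bigr do rewrite scalerA.
  rewrite -scaler_suml (_ : \sum_j _ = 0) ?scale0r //.
  transitivity ((Y *m invmx Y) i l); last by rewrite mulmxV // mxE eq_sym (negbTE li).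
  by rewrite mxE; apply: eq_bigr => j _; rewrite !mxE.
move=> i; split=> // e le.
have [q0 l0] := exists_log_weight (weight_of0 gW).
have := @corrected_add cc (dx i) 0 (a i) q0 e (la i) l0; rewrite addr0 => /(_ le).
move=> h; have := const_sub (proj2 (good0 cc) _ l0) h; congr const_poly.
by rewrite E0 add0r subKr.
Qed.

End ModuleStructure.

(** * Coordinates for a torus of codimension one *)

Section Subtoric.
Variables (k : fieldType) (d : nat).
Hypothesis char0 : [pchar k] =i pred0.
Local Notation n := d.+1.
Local Notation P := {mpoly k[n]}.
Local Notation wt := 'rV[int]_d.
Variable W : wt -> P -> Prop.
Hypothesis gW : grading W.
Hypothesis gW_jac : forall (x : 'I_n -> wt) (y : 'I_n -> P),
  (forall j, W (x j) (y j)) -> W (\sum_j x j) (jacobian y).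

Lemma subtoric_coordinates : exists (y q : 'I_n -> P),
  [/\ forall j, exists c, W c (y j),
      exists2 a, a != 0 & jacobian y = a%:MP
    & forall j, 'X_j = q j \mPo [tuple y i | i < n]].
Proof.
have [x [y [Wy xs J0]]] := exists_jacobian0 gW gW_jac.
have [D /all_and2[dD DW]] := weight_derivations gW.
have WJ := gW_jac Wy.
have divD i : divergence (D i) = 0 by exact: (divergence_weight dD DW i Wy J0 WJ).
have [E dE EE] := invariant_euler gW.
have EW := euler_weight EE.
have divE := divergence_invariant_euler dE EE gW_jac Wy xs J0.
pose u := volume D E.
have u0 : u != 0 by exact: (volume_neq0 char0 gW dD DW divD Wy xs J0 dE EW divE).
have Eu : E u = n%:R *: u.
  by rewrite (E_volume gW dD DW dE EW divE) -mul_mpolyC mpolyC_nat.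
have Du i : D i u = 0 by exact: (D_volume gW dD DW divD dE EW).
have inv := invariant_kernel char0 gW dD DW.
have Wu : W 0 u by apply/inv.
have nu0 : n%:R != 0 :> k by exact: natr_neq0.
have [z [g [Wz z0 g0 Ez zW]]] : exists z g, [/\ W 0 z, z != 0, g != 0, E z = g *: z
  & forall f, W 0 f -> exists q : {poly k}, f = (map_poly (@mpolyC n k) q).[z]].
  apply: (@invariants_polynomial k n char0 (W 0) E u n%:R) => //.
  - exact: gr_lin.
  - by move=> f h Wf Wh; rewrite -[0]addr0; exact: grM.
  - exact: gr1.
  - move=> f h f0 /inv Df /inv Dfh; apply/inv => i; apply: (mulfI f0); rewrite mulr0.
    by rewrite -[RHS](Dfh i) (derM (dD i)) Df mul0r add0r.
  - exact: EW.
  move=> f j Wf; rewrite -(invariant_differential char0 gW dD DW divD Wy xs J0 dE EW divE j Wf).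
  by rewrite -mul_mpolyC mpolyC_nat.
have Wopp := weight_of_opp char0 gW dD DW Wy xs J0.
have [cc ccP] := exists_correction char0 gW dE EW Wz z0 g0 Ez zW Wopp
  (fun i => weight_of_coord Wy J0 (fintype.lift ord0 i))
  (weights_det char0 gW dD DW Wy xs J0) (weight_multiple char0 gW dD DW Wy xs J0).
pose c j := zpoly z (cc j).
have Wc j : W 0 (c j) by exact: zpoly_weight.
(* The divergence stays n: the [c j] are invariant and the [D j] are free of divergence. *)
pose F f := E f - \sum_j c j * D j f.
have dF : derivation F by apply: derivation_sub => //; exact: derivation_comb.
have divF : divergence F = n%:R.
  rewrite divergence_sub divE divergence_comb // big1 ?subr0 // => j _.
  by rewrite divD mulr0 addr0; apply: (inv _).1.
pose v : 'rV[k]_n := \row_r if fintype.unlift ord0 r is Some i then 0 else n%:R.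
have dfr r : derivation (frame D F r) by exact: derivation_frame.
have divv r : divergence (frame D F r) = (v 0 r)%:MP.
  rewrite mxE /frame; case: fintype.unlift => [i|]; first by rewrite divD.
  by rewrite divF mpolyC_nat.
(* The frames with [F] and with [E] differ by a unipotent change, so nondegeneracy carries over. *)
have nd b : (forall r, \sum_j b j * frame D F r 'X_j = 0) -> forall j, b j = 0.
  move=> bF; apply: (frame_nondeg char0 gW dD DW divD Wy xs J0 dE EW divE) => r.
  case: (unliftP ord0 r) => [i|] ->.
    by have := bF (fintype.lift ord0 i); rewrite !frame_lift.
  rewrite frame0; transitivity (\sum_j b j * F 'X_j + \sum_i c i * \sum_j b j * D i 'X_j).
    under [X in _ + X]eq_bigr do rewrite mulr_sumr.
    rewrite [X in _ + X]exchange_big -big_split; apply: eq_bigr => j _ /=.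
    rewrite /F mulrBr mulr_sumr -[LHS]addr0 -addrA; congr (_ + _).
    rewrite addrC -sumrB big1 // => i _; ring.
  have := bF ord0; rewrite frame0 => ->; rewrite add0r big1 // => i _.
  by have := bF (fintype.lift ord0 i); rewrite frame_lift => ->; rewrite mulr0.
have tot f : weight_sum (joint_eigen (frame D F)) (fun=> True) f.
  have [s [sW ->]] := gr_total gW f; apply: weight_sum_sum => h /sW[e _ We].
  have [->|h0] := eqVneq h 0; first exact: weight_sum0.
  have He : weight_of W e by exists h.
  have [a [f0 [Wf0 f00 f0W] Ef0]] := exists_log_weight char0 gW dE EW Wz z0 g0 Ez zW Wopp He.
  have /size1_polyC Ea : const_poly (corrected cc e a) by apply: ccP; exists f0.
  have [q ->] := f0W _ We.
  set b := _`_0 in Ea.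
  (* The corrected logarithmic derivative of the generator is the constant b, and F z = g z; hence
     every z^i f0 is an eigenvector of [F], with eigenvalue g i + b. *)
  have Ff0 : F f0 = b *: f0.
    rewrite /F Ef0; under eq_bigr do rewrite (DW _ _ _ Wf0) -mul_mpolyC mulrA.
    rewrite -mulr_suml -mulrBl -mul_mpolyC; congr (_ * _).
    rewrite -(zpolyC z b) -Ea /corrected zpolyB zpoly_sum; congr (_ - _).
    by apply: eq_bigr => j _; rewrite zpolyZ -mul_mpolyC mulrC.
  have Fz : F z = g *: z.
    by rewrite /F Ez big1 ?subr0 // => j _; rewrite ((inv _).1 Wz) mulr0.
  rewrite /zpoly horner_coef mulr_suml.
  apply: (big_ind (weight_sum (joint_eigen (frame D F)) (fun=> True))) => [||i _].
  - exact: weight_sum0.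
  - by move=> *; exact: weight_sum_add.
  apply: (weight_sum1 (x := \row_r if fintype.unlift ord0 r is Some l
     then (e 0 l)%:~R else g * i%:R + b)) => // r.
  have Fzi : F (z ^+ i) = (g * i%:R) *: z ^+ i.
    rewrite (derXn dF) Fz -scalerAr -[i%:R]mpolyC_nat mul_mpolyC -scalerAl scalerA.
    case: (nat_of_ord i) => [|m]; first by rewrite !mulr0 !scale0r.
    by rewrite /= -exprSr.
  rewrite coef_map /= mul_mpolyC -scalerAl (derZ (dfr r)) mxE scalerA [_ * q`_i]mulrC -scalerA.
  congr (_ *: _); rewrite /frame; case: fintype.unlift => [l|].
    have Wzi : W 0 (z ^+ i) by rewrite -(mul0rn _ i); exact: gr_exp.
    by rewrite (derM (dD l)) ((inv _).1 Wzi) mul0r add0r (DW _ _ _ Wf0) -scalerAr.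
  by rewrite (derM dF) Fzi Ff0 scalerDl -scalerAl -scalerAr.
have [w [q [Ww [a a0 Jw] Eq]]] := diagonal_coordinates char0 dfr divv nd tot.
exists w, q; split=> //; last by exists a.
move=> j; have [e We] := Ww j.
have [||e' We' _] := eigen_weight char0 gW dD DW (c := fun i => e 0 (fintype.lift ord0 i)) (f := w j).
- apply: contraNneq a0 => wj; rewrite -(mpolyC_eq0 n) -Jw -(subst_at_id w j) wj.
  by rewrite (der0 (derivation_subst w j)).
- by move=> i; rewrite -(We (fintype.lift ord0 i)) frame_lift.
by exists e'.
Qed.

End Subtoric.

(** * Polynomial maps with constant jacobian *)

Section PolynomialMaps.
Variables (k : fieldType) (n : nat).
Hypothesis char0 : [pchar k] =i pred0.
Local Notation P := {mpoly k[n]}.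

Lemma comp_mpolyA (m l : nat) (f : {mpoly k[m]}) (q : m.-tuple {mpoly k[l]}) (r : l.-tuple P) :
  (f \mPo q) \mPo r = f \mPo [tuple tnth q i \mPo r | i < m].
Proof.
apply: (meval_ext char0) => x; rewrite !comp_mpoly_meval; apply: meval_eq => i.
by rewrite tnth_mktuple comp_mpoly_meval.
Qed.

Lemma jacobian_comp (y : 'I_n -> P) (q : n.-tuple P) :
  jacobian (fun i => y i \mPo q) = (jacobian y \mPo q) * jacobian (tnth q).
Proof.
rewrite /jacobian -(det_map_mx (comp_mpoly q)) -det_mulmx; congr (\det _).
apply/matrixP => i j; rewrite !mxE mderiv_comp; apply: eq_bigr => l _.
by rewrite !mxE.
Qed.

Lemma jacE (g : polyaut k n) : jac g = jacobian (tnth (polyaut_map g)).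
Proof. by []. Qed.

Lemma jacM (g h : polyaut k n) : jac (g * h)%g = (jac g \mPo polyaut_map h) * jac h.
Proof.
by rewrite !jacE -jacobian_comp; apply: eq_jacobian => i; rewrite /= tnth_mktuple.
Qed.

Lemma jac1 : jac (1%g : polyaut k n) = 1.
Proof.
by rewrite jacE -jacobian_id; apply: eq_jacobian => i; rewrite /= tnth_mktuple.
Qed.

Lemma jac_const (g : polyaut k n) : exists2 c, c != 0 & jac g = c%:MP.
Proof.
have : jac (g^-1 * g)%g = 1 by rewrite mulVg jac1.
rewrite jacM mulrC -mpolyC1 => h; have := mpoly_unit_const (oner_neq0 k) h.
set c := _@_0 => E; exists c => //; apply/eqP => c0; move/eqP: h.
by rewrite E c0 mul0r eq_sym mpolyC_eq0 oner_eq0.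
Qed.

(** Differentiating f(y) = 0 gives a nonsingular linear system for the partial derivatives of [f] at
    y; they vanish there, and induction on the degree makes [f] constant. *)
Lemma jacobian_independent (y : n.-tuple P) a : a != 0 -> jacobian (tnth y) = a%:MP ->
  forall f : P, f \mPo y = 0 -> f = 0.
Proof.
move=> a0 Jy f; have [N] := ubnP (msize f); elim: N f => // N IH f fN fy.
have [f0|f0] := eqVneq f 0; first by [].
have df : forall i, f^`M(i) = 0.
  move=> i; apply: IH.
    apply: (@leq_ltn_trans (msize f).-1); last by rewrite prednK // lt0n msize_poly_eq0.
    by apply: msize_mderiv; rewrite prednK // lt0n msize_poly_eq0.
  move: i; apply: (@det_unit_kernel _ _ (jacmx (tnth y))^T).
    by rewrite det_tr -/(jacobian _) Jy mpolyC_eq0.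
  move=> j; transitivity ((f \mPo y)^`M(j)); last by rewrite fy mderiv0.
  by rewrite mderiv_comp; apply: eq_bigr => i _; rewrite !mxE.
by move: fy; rewrite (gradient0 char0 df) comp_mpolyC => /eqP; rewrite mpolyC_eq0 => /eqP ->.
Qed.

(** Only Q o Y = id is given. Y o Q - id vanishes after composition with Y, and algebraic
    independence of the entries of Y cancels that factor. *)
Lemma coordinates_aut (y q : 'I_n -> P) a : a != 0 -> jacobian y = a%:MP ->
  (forall j, 'X_j = q j \mPo [tuple y i | i < n]) ->
  exists h : polyaut k n, forall i, tnth (polyaut_map h) i = y i.
Proof.
move=> a0 Jy qy; pose Y : polymap k n := [tuple y i | i < n].
pose Q : polymap k n := [tuple q i | i < n].
have QY : polymap_comp Q Y = polymap_id k n.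
  by apply: eq_from_tnth => i; rewrite !tnth_mktuple -qy.
have YQ : polymap_comp Y Q = polymap_id k n.
  apply: eq_from_tnth => i; apply/eqP; rewrite -subr_eq0; apply/eqP.
  apply: (jacobian_independent (y := Y) a0).
    by rewrite -Jy; apply: eq_jacobian => j; rewrite tnth_mktuple.
  rewrite comp_mpolyB -[tnth (polymap_comp Y Q) i \mPo Y](tnth_mktuple (fun i => tnth (polymap_comp Y Q) i \mPo Y)).
  rewrite -[[tuple _ | _ < _]]/(polymap_comp (polymap_comp Y Q) Y) -polymap_compA QY polymap_compp1.
  by rewrite tnth_mktuple [tnth (polymap_id _ _) _]tnth_mktuple comp_mpolyXU -tnth_nth tnth_mktuple subrr.
have YQP : mutual_inverse (Y, Q) by rewrite /mutual_inverse /= YQ QY !eqxx.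
by exists (MkPolyaut YQP) => i; rewrite /polyaut_map /= tnth_mktuple.
Qed.

End PolynomialMaps.

(** * Torus actions *)

Section TorusCharacters.
Variables (k : fieldType) (d : nat).
Hypothesis char0 : [pchar k] =i pred0.
Local Notation wt := 'rV[int]_d.

Definition chr (x : wt) (t : torus k d) : k := \prod_i Gm_val (t i) ^ x 0 i.

Lemma Gm_neq0 (t : Gm k) : Gm_val t != 0. Proof. by case: t. Qed.

Lemma torusM (s t : torus k d) i : Gm_val ((s * t)%g i) = Gm_val (s i) * Gm_val (t i).
Proof. by rewrite ffunE. Qed.

Lemma torus1 i : Gm_val ((1%g : torus k d) i) = 1.
Proof. by rewrite ffunE. Qed.

Lemma torusV (t : torus k d) i : Gm_val (t^-1%g i) = (Gm_val (t i))^-1.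
Proof. by rewrite ffunE. Qed.

Lemma chrD x y t : chr (x + y) t = chr x t * chr y t.
Proof.
rewrite /chr -big_split; apply: eq_bigr => i _ /=.
by rewrite mxE expfzDr // Gm_neq0.
Qed.

Lemma chr0 t : chr 0 t = 1.
Proof. by rewrite /chr big1 // => i _; rewrite mxE. Qed.

Lemma chr_sum I (s : seq I) (F : I -> wt) t :
  chr (\sum_(i <- s) F i) t = \prod_(i <- s) chr (F i) t.
Proof. exact: (big_morph (fun x => chr x t) (fun a b => chrD a b t) (chr0 t)). Qed.

Lemma chrM x s t : chr x (s * t)%g = chr x s * chr x t.
Proof.
rewrite /chr -big_split; apply: eq_bigr => i _ /=.
by rewrite torusM expfzMl.
Qed.

Lemma chr1 x : chr x 1%g = 1.
Proof. by rewrite /chr big1 // => i _; rewrite torus1 exp1rz. Qed.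

Lemma two_neq0 : (2%:R : k) != 0. Proof. exact: natr_neq0. Qed.

Lemma two_exp (m : int) : (2%:R : k) ^ m = 1 -> m = 0.
Proof.
have Q (j : nat) : (2%:R : k) ^+ j = 1 -> j = 0%N.
  rewrite -natrX -[1]/(1%:R) => /(natr_inj char0); case: j => // j.
  by rewrite expnS => /eqP; rewrite muln_eq1.
case: m => j; first by move/Q => ->.
move=> h; have : (2%:R : k) ^+ j.+1 = 1 by rewrite -[LHS]invrK [X in X^-1]h invr1.
by move/Q.
Qed.

(* The one-parameter subgroup l evaluated at 2. *)
Definition two_pow (l : wt) : torus k d :=
  [ffun i => MkGm (expfz_neq0 (l 0 i) two_neq0)].

Lemma chr_two_pow x l : chr x (two_pow l) = 2%:R ^ (\sum_i l 0 i * x 0 i).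
Proof.
rewrite /chr (big_morph (fun m : int => (2%:R : k) ^ m) (id1 := 1) (op1 := *%R)) //.
  by apply: eq_bigr => i _; rewrite ffunE /= exprz_exp.
by move=> a b; rewrite expfzDr // two_neq0.
Qed.

Lemma chr_separate x y : x <> y -> exists t, chr x t <> chr y t.
Proof.
move=> xy; have [i xyi] : exists i, x 0 i != y 0 i.
  apply/existsP; apply: contra_notT xy; rewrite negb_exists => /forallP h.
  by apply/rowP => i; move: (h i); rewrite negbK => /eqP.
pose l : wt := delta_mx 0 i; exists (two_pow l); rewrite !chr_two_pow => e.
have S (z : wt) : \sum_j l 0 j * z 0 j = z 0 i.
  rewrite (bigD1 i) //= mxE !eqxx mul1r big1 ?addr0 // => j /negbTE ji.
  by rewrite mxE ji andbF mul0r.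
move: e; rewrite !S => e; move/eqP: xyi; apply; apply/eqP; rewrite -subr_eq0; apply/eqP.
apply: two_exp; rewrite expfzDr ?two_neq0 // e -expfzDr ?two_neq0 // subrr.
by [].
Qed.

(** Artin's argument with vector coefficients: subtracting [chr y t] times the relation at r from
    the relation at r t removes the term of [y]. *)
Lemma chr_independent (P : lmodType k) (s : seq wt) (h : wt -> P) : uniq s ->
  (forall t, \sum_(x <- s) chr x t *: h x = 0) -> forall x, x \in s -> h x = 0.
Proof.
elim: s h => [|y s IH] h //= /andP[ys us] h0.
have hs x : x \in s -> h x = 0.
  move=> xs; have [t txy] : exists t, chr x t <> chr y t.
    by apply: chr_separate => xy; rewrite -xy xs in ys.
  have : (chr x t - chr y t) *: h x = 0.
    apply: (IH (fun x => (chr x t - chr y t) *: h x)) => // r.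
    have := h0 (r * t)%g; have := h0 r; rewrite !big_cons chrM => e1 e2.
    have : chr y r * chr y t *: h y + \sum_(j <- s) chr j (r * t)%g *: h j -
       chr y t *: (chr y r *: h y + \sum_(j <- s) chr j r *: h j) = 0.
      by rewrite e1 e2 scaler0 subr0.
    rewrite scalerDr scalerA [chr y t * _]mulrC opprD addrACA subrr add0r.
    rewrite scaler_sumr -sumrB => e; rewrite -[RHS]e; apply: eq_bigr => j _.
    by rewrite chrM !scalerA -scalerBl; congr (_ *: _); ring.
  by move/eqP; rewrite scaler_eq0 subr_eq0 => /orP[/eqP|/eqP].
move=> x; rewrite inE => /orP[/eqP->|]; last exact: hs.
have := h0 1%g; rewrite big_cons chr1 scale1r big_seq big1 ?addr0 // => j js.
by rewrite hs ?scaler0.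
Qed.

End TorusCharacters.

Section TorusGrading.
Variables (k : fieldType) (d n : nat).
Hypothesis char0 : [pchar k] =i pred0.
Local Notation P := {mpoly k[n]}.
Local Notation wt := 'rV[int]_d.
Variable phi : {multiplicative torus k d -> polyaut k n}.
Hypothesis phi_morphic : morphic_action phi.
Hypothesis phi_inj : injective phi.

Definition pullback (t : torus k d) (f : P) : P := f \mPo polyaut_map (phi t).
Definition semi_invariant (x : wt) (f : P) : Prop :=
  forall t, pullback t f = chr x t *: f.

Lemma pullbackM s t f : pullback (s * t)%g f = pullback t (pullback s f).
Proof.
rewrite /pullback (comp_mpolyA char0) gmulfM; congr (_ \mPo _).
Qed.

Lemma phi1 : phi 1%g = 1%g.
Proof. by apply: (@mulgI _ (phi 1%g)); rewrite -gmulfM !mulg1. Qed.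

Lemma pullback1 f : pullback 1%g f = f.
Proof. by rewrite /pullback phi1 comp_mpoly_id. Qed.

Lemma pullback_linear t : linear (pullback t).
Proof. by move=> c f g; rewrite /pullback comp_mpolyD comp_mpolyZ. Qed.

(** The pullback is a polynomial in t, its inverse and x. Its monomials are collected by weight
    [w m], the exponent of t_i minus that of its inverse. *)
Lemma pullback_expansion f : exists (s : seq wt) (h : wt -> P), uniq s /\
  forall t, pullback t f = \sum_(x <- s) chr x t *: h x.
Proof.
have [F FE] := phi_morphic.
pose G : {mpoly k[d + d + n]} := f \mPo [tuple F i | i < n].
pose w (m : 'X_{1..d + d + n}) : wt :=
  \row_i ((m (lshift n (lshift d i)))%:Z - (m (lshift n (rshift d i)))%:Z).
pose mx (m : 'X_{1..d + d + n}) := [multinom m (rshift (d + d) j) | j < n].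
exists (undup (map w (msupp G))).
exists (fun x => \sum_(m <- msupp G | w m == x) G@_m *: 'X_[mx m]).
split=> [|t]; first exact: undup_uniq.
transitivity (\sum_(m <- msupp G) chr (w m) t *: (G@_m *: 'X_[mx m])); last first.
  under [RHS]eq_bigr do rewrite scaler_sumr big_mkcond.
  rewrite exchange_big; apply: eq_big_seq => m mG /=.
  rewrite (bigD1_seq (w m)) ?undup_uniq ?mem_undup ?map_f //= eqxx.
  by rewrite big1 ?addr0 // => x; rewrite eq_sym => /negbTE ->.
apply: (meval_ext char0) => x.
pose v := row_mx (torus_coord t) (\row_j x j).
transitivity (G.@[v 0]).
  rewrite !comp_mpoly_meval; apply: meval_eq => i; rewrite tnth_mktuple.
  have /rowP/(_ i) := FE t (\row_j x j); rewrite !mxE => <-.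
  by apply: meval_eq => j; rewrite mxE.
rewrite mevalE raddf_sum /=; apply: eq_bigr => m _.
rewrite !mevalZ mevalX mulrCA; congr (_ * _).
rewrite big_split_ord big_split_ord /= /chr -big_split /=; congr (_ * _); last first.
  by apply: eq_bigr => j _; rewrite /v row_mxEr mxE mnmE.
apply: eq_bigr => i _; rewrite /v !row_mxEl row_mxEr !mxE expfzDr ?Gm_neq0 // torusV.
by rewrite -exprz_inv.
Qed.

(** Expanding the pullback along t r in two ways and comparing coefficients of the characters of t
    shows that each [h x] is semi-invariant; at t = 1 they add up to [f]. *)
Lemma semi_invariant_total f : weight_sum semi_invariant (fun=> True) f.
Proof.
have [s [h [us fE]]] := pullback_expansion f.
have hW x : x \in s -> semi_invariant x (h x).
  move=> xs r; apply/eqP; rewrite -subr_eq0; apply/eqP; move: x xs.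
  apply: (chr_independent char0 (h := fun x => pullback r (h x) - chr x r *: h x)) => // t.
  have := pullbackM t r f; rewrite !fE => e.
  under eq_bigr do rewrite scalerBr.
  rewrite sumrB; apply/eqP; rewrite subr_eq0; apply/eqP.
  transitivity (pullback r (\sum_(x <- s) chr x t *: h x)).
    rewrite /pullback raddf_sum; apply: eq_bigr => x _ /=; by rewrite comp_mpolyZ.
  by rewrite -e; apply: eq_bigr => x _; rewrite chrM scalerA.
exists (map h s); split=> [_ /mapP[x xs ->]|]; first by exists x => //; exact: hW.
rewrite -[LHS](pullback1 f) fE big_map; apply: eq_bigr => x _.
by rewrite chr1 scale1r.
Qed.

Lemma semi_invariant_indep : weights_independent semi_invariant.
Proof.
apply: (@eigen_independent _ _ _ _ pullback (fun t x => chr x t)) => [t|x y].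
  exact: pullback_linear.
exact: chr_separate.
Qed.

Lemma semi_invariant_lin x c f g :
  semi_invariant x f -> semi_invariant x g -> semi_invariant x (c *: f + g).
Proof.
by move=> Wf Wg t; rewrite pullback_linear Wf Wg scalerDr !scalerA mulrC.
Qed.

Lemma semi_invariant0 x : semi_invariant x 0.
Proof. by move=> t; rewrite /pullback comp_mpoly0 scaler0. Qed.

Lemma jacobian_pullback (x : 'I_n -> wt) (y : 'I_n -> P) t :
  (forall j, semi_invariant (x j) (y j)) ->
  chr (\sum_j x j) t *: jacobian y = pullback t (jacobian y) * jac (phi t).
Proof.
move=> Wy; rewrite /pullback jacE -jacobian_comp.
rewrite [RHS](eq_jacobian (y' := fun j => chr (x j) t *: y j)) => [|j]; last exact: Wy.
rewrite chr_sum /jacobian.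
have -> : jacmx (fun j => chr (x j) t *: y j) =
    diag_mx (\row_j (chr (x j) t)%:MP) *m jacmx y.
  by apply/matrixP => i j; rewrite mul_diag_mx !mxE mderivZ mul_mpolyC.
rewrite det_mulmx det_diag -mul_mpolyC rmorph_prod; congr (_ * _).
by apply: eq_bigr => j _; rewrite mxE.
Qed.

Lemma torus_grading : grading semi_invariant.
Proof.
split.
- exact: semi_invariant_lin.
- exact: semi_invariant0.
- by move=> t; rewrite /pullback comp_mpoly1 chr0 scale1r.
- move=> x y f g Wf Wg t; rewrite /pullback rmorphM /= -!/(pullback _ _) Wf Wg.
  by rewrite chrD -scalerAl -scalerAr scalerA.
- exact: semi_invariant_indep.
- exact: semi_invariant_total.
(* The jacobian of each [phi t] is a constant, so [jacobian y] is an eigenvector of all pullbacks.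
   Any nonzero component of it determines the eigenvalues, which therefore form a character. *)
- move=> x y Wy; have [J0|J0] := eqVneq (jacobian y) 0.
    by exists 0; rewrite J0; exact: semi_invariant0.
  have eigen t : exists a, pullback t (jacobian y) = a *: jacobian y.
    have [c c0 Ec] := jac_const (phi t).
    exists (c^-1 * chr (\sum_j x j) t); rewrite -scalerA (jacobian_pullback t Wy) Ec.
    by rewrite mulrC mul_mpolyC scalerA mulVf // scale1r.
  pose pr := proj semi_invariant_lin semi_invariant0 semi_invariant_total.
  have pr_lin e := proj_linear semi_invariant_lin semi_invariant0
    semi_invariant_indep semi_invariant_total e.
  have [s us Es] := proj_support semi_invariant_lin semi_invariant0
    semi_invariant_indep semi_invariant_total (jacobian y).
  have [e es nz] : exists2 e, e \in s & pr e (jacobian y) != 0.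
    apply/hasP; apply: contraNT J0 => /hasPn h; rewrite Es big_seq big1 // => e /h.
    by rewrite negbK => /eqP.
  exists e => t; have [a Ea] := eigen t; rewrite Ea; congr (_ *: _).
  apply/eqP; rewrite -subr_eq0; have := nz; apply: contraNT => ae.
  suff : (a - chr e t) *: pr e (jacobian y) = 0.
    by move/eqP; rewrite scaler_eq0 (negbTE ae).
  have prD : {morph pr e : f g / f + g}.
    by move=> f g; have := pr_lin e 1 f g; rewrite !scale1r.
  have p0 : pr e 0 = 0 by exact: (proj0 _ _ semi_invariant_indep).
  have prZ c f : pr e (c *: f) = c *: pr e f.
    by have := pr_lin e c f 0; rewrite !addr0 -/pr p0 addr0.
  have prW b : semi_invariant b (pr b (jacobian y)) by exact: proj_weight.
  have prE b : pr b (jacobian y) \mPo polyaut_map (phi t) = chr b t *: pr b (jacobian y).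
    exact: prW.
  apply/eqP; rewrite scalerBl subr_eq0 -prZ -Ea {1}Es /pullback raddf_sum.
  rewrite (big_morph _ prD p0) (bigD1_seq e) //= big1 ?addr0 => [|b be].
    by rewrite prE prZ /pr (proj_id _ _ semi_invariant_indep).
  rewrite prE prZ /pr (proj_other _ _ semi_invariant_indep _ _ (prW b)) ?scaler0 //.
  exact/eqP.
move=> l lW.
(* If [l] pairs to zero with all weights, the point [two_pow l] acts trivially and is 1 by
   injectivity of [phi]; as 2 is not a root of unity, [l] is zero. *)
have tot f : pullback (two_pow char0 l) f = f.
  have [s [sW ->]] := semi_invariant_total f.
  rewrite /pullback raddf_sum; apply: eq_big_seq => g /sW[x _ Wg] /=.
  rewrite -[LHS]/(pullback _ g) Wg; have [->|g0] := eqVneq g 0; first by rewrite scaler0.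
  by rewrite chr_two_pow (lW _ _ Wg g0) scale1r.
have : phi (two_pow char0 l) = phi 1%g.
  apply: polyaut_map_inj; apply: eq_from_tnth => i.
  have := tot 'X_i; rewrite /pullback comp_mpolyXU -tnth_nth => ->.
  by have := pullback1 'X_i; rewrite /pullback comp_mpolyXU -tnth_nth => ->.
move/phi_inj => E; apply/rowP => i; rewrite mxE; apply: (two_exp char0).
have := congr1 (fun t : torus k d => Gm_val (t i)) E.
by rewrite torus1 ffunE.
Qed.

End TorusGrading.

(** * Fusion of diagonal automorphisms *)

Section ConjugationIdentities.
Variable A : groupType.
Implicit Types f g h w : A.

Lemma conj_mul_conj h g f :
  (h * g * h^-1 * (h * f * h^-1) = h * (g * f * g^-1) * h^-1 * (h * g * h^-1))%g.
Proof. by rewrite !mulgA !mulgVK. Qed.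

Lemma conj_conj h w f :
  (h * (h^-1 * w * h * f * (h^-1 * w * h)^-1) * h^-1 = w * (h * f * h^-1) * w^-1)%g.
Proof. by rewrite !invgM invgK !mulgA mulgV mul1g mulgK. Qed.

End ConjugationIdentities.

Section DiagonalAutomorphisms.
Variables (k : fieldType) (n : nat).
Hypothesis char0 : [pchar k] =i pred0.
Local Notation P := {mpoly k[n]}.

Definition diagonal (g : polyaut k n) (a : 'I_n -> k) : Prop :=
  forall i, tnth (polyaut_map g) i = a i *: 'X_i.

Lemma polyaut_ext (g h : polyaut k n) :
  (forall i, tnth (polyaut_map g) i = tnth (polyaut_map h) i) -> g = h.
Proof. by move=> gh; apply: polyaut_map_inj; exact: eq_from_tnth. Qed.

Lemma polyaut_mulE (g h : polyaut k n) i :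
  tnth (polyaut_map (g * h)%g) i = tnth (polyaut_map g) i \mPo polyaut_map h.
Proof. by rewrite /= tnth_mktuple. Qed.

Lemma comp_coordinate (c : k) i (q : n.-tuple P) : (c *: 'X_i) \mPo q = c *: tnth q i.
Proof. by rewrite comp_mpolyZ comp_mpolyXU -tnth_nth. Qed.

Lemma monomial_aut (s : {perm 'I_n}) (c : 'I_n -> k) : (forall i, c i != 0) ->
  exists w : polyaut k n, forall i, tnth (polyaut_map w) i = c i *: 'X_(s i).
Proof.
move=> c0; pose A : polymap k n := [tuple c i *: 'X_(s i) | i < n].
pose B : polymap k n := [tuple (c ((s^-1)%g i))^-1 *: 'X_((s^-1)%g i) | i < n].
have AB : mutual_inverse (A, B).
  apply/andP; split; apply/eqP/eq_from_tnth => i;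
    rewrite !tnth_mktuple comp_coordinate tnth_mktuple scalerA.
    by rewrite permK mulfV // scale1r.
  by rewrite permKV mulVf // scale1r.
by exists (MkPolyaut AB) => i; rewrite /polyaut_map /= tnth_mktuple.
Qed.

Lemma jac_monomial (s : {perm 'I_n}) (c : 'I_n -> k) (w : polyaut k n) :
  (forall i, tnth (polyaut_map w) i = c i *: 'X_(s i)) ->
  jac w = ((\prod_i c i) * (-1) ^+ s)%:MP.
Proof.
move=> wE; rewrite jacE /jacobian.
have -> : jacmx (tnth (polyaut_map w)) =
    map_mx (@mpolyC n k) (diag_mx (\row_i c i) *m perm_mx s).
  apply/matrixP => i j; rewrite mul_diag_mx !mxE wE mderivZ mderivXU.
  by rewrite mpolyCM mul_mpolyC mpolyC_nat.
rewrite det_map_mx det_mulmx det_diag det_perm; congr (_%:MP); congr (_ * _).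
by apply: eq_bigr => i _; rewrite mxE.
Qed.

Lemma jac_conj (h w : polyaut k n) : jac w = 1 -> jac (h^-1 * w * h)%g = 1.
Proof.
move=> w1; rewrite !jacM w1 mulr1.
have [c c0 Ec] := jac_const h; have [e e0 Ee] := jac_const (h^-1)%g.
have : jac (h^-1 * h)%g = 1 by rewrite mulVg jac1.
by rewrite jacM Ee !comp_mpolyC.
Qed.

(* Differentiating g a = b g at the origin, with a and b diagonal, gives a linear
   intertwiner; a nonzero term of the Leibniz expansion of its determinant is a
   permutation carrying all the a's to the b's simultaneously. *)
Lemma diagonal_fusion (g : polyaut k n) : exists s : {perm 'I_n},
  forall (x y : polyaut k n) a b, diagonal x a -> diagonal y b -> (g * x = y * g)%g ->
  forall i, b i = a (s i).
Proof.
pose o : 'I_n -> k := fun=> 0.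
pose M : 'M[k]_n := \matrix_(i, j) ((tnth (polyaut_map g) i)^`M(j)).@[o].
have M0 : \det M != 0.
  have [c c0 Ec] := jac_const g.
  have <- : (jac g).@[o] = \det M.
    by rewrite /jac -det_map_mx; congr (\det _); apply/matrixP => i j; rewrite !mxE.
  by rewrite Ec mevalC.
have [s sM] : exists s : {perm 'I_n}, \prod_i M i (s i) != 0.
  apply/existsP; apply: contraNT M0; rewrite negb_exists => /forallP h.
  rewrite /determinant big1 // => s _; move: (h s); rewrite negbK => /eqP ->.
  by rewrite mulr0.
exists s => x y a b xa yb gxy i.
have Mi : M i (s i) != 0 by move/prodf_neq0/(_ i isT): sM.
have := congr1 (fun p : P => (p^`M(s i)).@[o])
   (congr1 (fun f : polyaut k n => tnth (polyaut_map f) i) gxy).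
rewrite !polyaut_mulE yb comp_coordinate mderivZ mevalZ mderiv_comp.
have xo (f : P) : (f \mPo polyaut_map x).@[o] = f.@[o].
  rewrite comp_mpoly_meval; apply: meval_eq => j.
  by rewrite xa mevalZ mevalXU mulr0.
rewrite (raddf_sum (meval o)) (bigD1 (s i)) //= big1 => [|l li].
  rewrite addr0 mevalM xo xa mderivZ mderivXU eqxx mevalZ meval1 mulr1 => e.
  by apply: (mulIf Mi); rewrite [in LHS]mxE -e mulrC mxE.
by rewrite mevalM xa mderivZ mderivXU (negbTE li) mevalZ meval0 !mulr0.
Qed.

(** In the coordinates [h], the permutation found by [diagonal_fusion] is realised by a monomial
    automorphism. It permutes diagonal entries, so it normalises the group cut out by the symmetric
    condition [cond], and it agrees with [g] on [S]. The scalars [c] are at disposal to bring it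
    into [G]. *)
Lemma diagonal_property_F (G H : polyaut k n -> Prop) (cond : ('I_n -> k) -> Prop)
    (h : polyaut k n) :
  (forall (s : {perm 'I_n}) a, cond a -> cond (fun i => a (s i))) ->
  (forall f, H f <-> exists2 a, cond a & diagonal (h * f * h^-1)%g a) ->
  (forall s : {perm 'I_n}, exists c w, [/\ forall i, c i != 0,
     forall i, tnth (polyaut_map w) i = c i *: 'X_(s i) & G (h^-1 * w * h)%g]) ->
  property_F G H.
Proof.
move=> cond_perm HE Gw S g SH Gg gS.
have [s sP] := diagonal_fusion (h * g * h^-1)%g.
have [c [w [c0 wE Gw']]] := Gw s.
have [W GW hW] : exists2 W, G W &
    forall f, (h * (W * f * W^-1) * h^-1 = w * (h * f * h^-1) * w^-1)%g.
  by exists (h^-1 * w * h)%g => // f; exact: conj_conj.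
have toW f a : diagonal f a -> diagonal (w * f * w^-1)%g (fun i => a (s i)).
  move=> fa i; rewrite polyaut_mulE polyaut_mulE wE comp_coordinate fa.
  rewrite scalerA mulrC -scalerA comp_mpolyZ -wE -polyaut_mulE mulgV.
  by congr (_ *: _); rewrite /= tnth_mktuple.
have ofW f b : diagonal (w * f * w^-1)%g b -> diagonal f (fun i => b ((s^-1)%g i)).
  have : (w * f * w^-1 * w = w * f)%g by rewrite mulgVK.
  move: (w * f * w^-1)%g => y yw yb i.
  have := congr1 (fun x : polyaut k n => tnth (polyaut_map x) ((s^-1)%g i)) yw.
  rewrite !polyaut_mulE yb wE !comp_coordinate wE permKV scalerA mulrC -scalerA.
  by move/(scalerI (c0 _)).
exists W.
  split=> // f; split=> /HE[a ca fa]; apply/HE.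
    rewrite hW in fa; exists (fun i => a ((s^-1)%g i)); first exact: cond_perm.
    exact: ofW.
  exists (fun i => a (s i)); first exact: cond_perm.
  by rewrite hW; exact: toW.
move=> f Sf; have /HE[a ca fa] := SH _ Sf; have /HE[b cb fb] := gS _ Sf.
have ab := sP _ _ _ _ fa fb (conj_mul_conj h g f).
have E : (h * (g * f * g^-1) * h^-1 = h * (W * f * W^-1) * h^-1)%g.
  apply: polyaut_ext => i; rewrite hW; apply: (etrans (fb i)); rewrite ab.
  exact: (esym (toW _ _ fa i)).
by move/mulIg/mulgI: E.
Qed.

End DiagonalAutomorphisms.

(** * Independent characters take arbitrary values *)

Section CharactersSurjective.
Variables (k : closedFieldType) (d : nat).

Lemma int_root (c : k) (m : int) : m != 0 -> c != 0 -> exists b : Gm k, Gm_val b ^ m = c.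
Proof.
have pos (j : nat) e : (0 < j)%N -> e != 0 -> exists b : Gm k, Gm_val b ^+ j = e.
  move=> j0 e0; have : size ('X^j - e%:P : {poly k}) != 1%N by rewrite size_XnsubC // eqSS -lt0n.
  case/closed_rootP => b; rewrite /root !hornerE subr_eq0 => /eqP be.
  have b0 : b != 0.
    by apply: contraNneq e0 => b0; rewrite -be b0 expr0n eqn0Ngt j0.
  by exists (MkGm b0).
case: m => j m0 c0; first by apply: pos; rewrite ?lt0n.
have [b Eb] := pos j.+1 c^-1 isT (invr_neq0 c0); exists b.
by rewrite -[LHS]/((Gm_val b ^+ j.+1)^-1) Eb invrK.
Qed.

(** With b_j a root of a_j of order det X, the point with coordinates \prod_j b_j ^ (adj X)_lj
    works, because X adj X = det X. *)
Lemma chr_surjective (x : 'I_d -> 'rV[int]_d) (a : 'I_d -> k) :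
  \det (\matrix_(i, l) x i 0 l) != 0 -> (forall i, a i != 0) ->
  exists t : torus k d, forall i, chr (x i) t = a i.
Proof.
set X := \matrix_(i, l) _ => X0 a0.
have [b Eb] := fin_all_exists (fun i => int_root X0 (a0 i)).
have prod0 l : \prod_j Gm_val (b j) ^ (\adj X l j) != 0.
  by apply/prodf_neq0 => j _; rewrite expfz_neq0 // Gm_neq0.
exists [ffun l => MkGm (prod0 l)] => i.
have prodz (s : seq 'I_d) (F : 'I_d -> k) (m : int) :
    (\prod_(j <- s) F j) ^ m = \prod_(j <- s) F j ^ m.
  apply: (big_morph (fun y => y ^ m)) => [y z|]; [exact: expfzMl | exact: exp1rz].
transitivity (\prod_l \prod_j Gm_val (b j) ^ (X i l * \adj X l j)).
  rewrite /chr; apply: eq_bigr => l _; rewrite ffunE /= prodz; apply: eq_bigr => j _.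
  by rewrite exprz_exp [X i l]mxE mulrC.
rewrite exchange_big /=.
have sumz (y : k) (F : 'I_d -> int) : y != 0 -> \prod_l y ^ F l = y ^ (\sum_l F l).
  by move=> y0; apply/esym/(big_morph (fun m : int => y ^ m)) => // m m'; exact: expfzDr.
rewrite (eq_bigr (fun j => Gm_val (b j) ^ ((X *m \adj X) i j))) => [|j _]; last first.
  by rewrite sumz ?Gm_neq0 // mxE.
rewrite mul_mx_adj (bigD1 i) //= mxE eqxx mulr1n Eb big1 ?mulr1 // => j ji.
by rewrite mxE eq_sym (negbTE ji).
Qed.

End CharactersSurjective.

(** * The torus as a group of diagonal automorphisms *)

Section Linearization.
Variables (k : closedFieldType) (d n : nat).
Hypothesis char0 : [pchar k] =i pred0.
Variable phi : {multiplicative torus k d -> polyaut k n}.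
Variables (x : 'I_n -> 'rV[int]_d) (h : polyaut k n).
Hypothesis hx : forall j, semi_invariant phi (x j) (tnth (polyaut_map h) j).

Lemma linearized t : diagonal (h * phi t * h^-1)%g (fun j => chr (x j) t).
Proof.
move=> i; have E : tnth (polyaut_map (h * phi t)%g) i = chr (x i) t *: tnth (polyaut_map h) i.
  by rewrite polyaut_mulE; exact: hx.
rewrite polyaut_mulE E comp_mpolyZ -polyaut_mulE mulgV; congr (_ *: _).
by rewrite /= tnth_mktuple.
Qed.

Lemma diagonal_neq0 (f : polyaut k n) a : diagonal f a -> forall i, a i != 0.
Proof.
move=> fa i; have [c c0 Ec] := jac_const f; apply: contraNneq c0 => ai.
rewrite -(mpolyC_eq0 n) -Ec jacE -(subst_at_id _ i) fa ai scale0r.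
by rewrite (der0 (derivation_subst _ i)).
Qed.

Lemma image_diagonal (H : polyaut k n -> Prop) (cond : ('I_n -> k) -> Prop) :
  (forall g, H g <-> exists t, phi t = g) ->
  (forall t, cond (fun j => chr (x j) t)) ->
  (forall a, cond a -> (forall j, a j != 0) -> exists t, forall j, chr (x j) t = a j) ->
  forall f, H f <-> exists2 a, cond a & diagonal (h * f * h^-1)%g a.
Proof.
move=> HE cond_chr chr_cond f; split=> [/HE[t <-]|[a ca fa]].
  by exists (fun j => chr (x j) t); [exact: cond_chr | exact: linearized].
have [t ta] := chr_cond a ca (diagonal_neq0 fa).
apply/HE; exists t; suff : (h * phi t * h^-1 = h * f * h^-1)%g by move/mulIg/mulgI.
apply: polyaut_ext => i; apply: (etrans (linearized t i)); rewrite ta.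
exact: (esym (fa i)).
Qed.

End Linearization.

Lemma jac_neq0 (k : fieldType) n (y : n.-tuple {mpoly k[n]}) (z : 'I_n -> {mpoly k[n]}) a :
  a != 0 -> jacobian z = a%:MP -> (forall i, tnth y i = z i) -> jacobian (tnth y) != 0.
Proof. by move=> a0 Jz yz; rewrite (eq_jacobian yz) Jz mpolyC_eq0. Qed.

Theorem theorem9 (k : closedFieldType) (char0 : [pchar k] =i pred0) (n : nat) :
  (forall H : polyaut k n -> Prop,
     is_torus n H -> property_F (@Aut_full k n) H) /\
  ((0 < n)%N -> forall H : polyaut k n -> Prop,
     is_torus_star n.-1 H -> property_F (@Aut_star k n) H).
Proof.
split=> [H [phi [mor inj HE]]|].
  have gW := torus_grading char0 mor inj.
  have [y [q [/fin_all_exists[x Wy] [a a0 Jy] Eq]]] := toric_coordinates char0 gW.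
  have [h hy] := coordinates_aut char0 a0 Jy Eq.
  have Wh j : semi_invariant phi (x j) (tnth (polyaut_map h) j) by rewrite hy.
  have X0 := toric_weights_det char0 gW Wh (jac_neq0 a0 Jy hy).
  have HD := image_diagonal (cond := fun=> True) Wh HE.
  apply: (diagonal_property_F (cond := fun=> True) (h := h)) => //.
    by apply: HD => // b _ b0; exact: chr_surjective X0 b0.
  move=> s; have [i|w Ew] := monomial_aut (k := k) s (c := fun=> 1); first exact: oner_neq0.
  by exists (fun=> 1), w; split=> // i; exact: oner_neq0.
case: n => // d _ H [[phi [mor inj HE]] Hstar].
have gW := torus_grading char0 mor inj.
have jphi t : jac (phi t) = 1 by apply: Hstar; apply/HE; exists t.
have gW_jac (x : 'I_d.+1 -> 'rV[int]_d) (y : 'I_d.+1 -> {mpoly k[d.+1]}) :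
    (forall j, semi_invariant phi (x j) (y j)) ->
    semi_invariant phi (\sum_j x j) (jacobian y).
  by move=> Wy t; have := jacobian_pullback t Wy; rewrite jphi mulr1.
have [y [q [/fin_all_exists[x Wy] [a a0 Jy] Eq]]] := subtoric_coordinates char0 gW gW_jac.
have [h hy] := coordinates_aut char0 a0 Jy Eq.
have Wh j : semi_invariant phi (x j) (tnth (polyaut_map h) j) by rewrite hy.
have Jh := jac_neq0 a0 Jy hy.
have x_sum : \sum_j x j = 0.
  (* The jacobian has weight \sum_j x_j and is a nonzero constant, which has weight zero. *)
  apply: (gr_unique gW (gW_jac _ _ Wy)); rewrite Jy ?mpolyC_eq0 //.
  rewrite -[a%:MP]mulr1 mul_mpolyC; apply: (gr_scale gW); exact: gr1.
have [D /all_and2[dD DW]] := weight_derivations gW.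
have X0 := weights_det char0 gW dD DW Wh x_sum Jh.
have chr_prod (t : torus k d) : \prod_j chr (x j) t = 1 by rewrite -chr_sum x_sum chr0.
apply: (diagonal_property_F (cond := fun b => \prod_j b j = 1) (h := h)).
- move=> s b b1; apply: etrans b1; apply: esym.
  exact: (reindex_inj (@perm_inj _ s)).
- apply: (image_diagonal (cond := fun b => \prod_j b j = 1) Wh HE) => [t|b b1 b0]; first exact: chr_prod.
  (* All entries but the one at [ord0] are prescribed; that one is then forced, since both products
     equal 1. *)
  have [t tb] := chr_surjective X0 (fun i => b0 (fintype.lift ord0 i)).
  exists t => j; case: (unliftP ord0 j) => [i ->|->]; first exact: tb.
  have Eb := b1; have Ec := chr_prod t; rewrite big_ord_recl in Eb; rewrite big_ord_recl in Ec.
  apply: (@mulIf _ (\prod_i b (fintype.lift ord0 i))).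
    by apply/prodf_neq0 => i _; exact: b0.
  by rewrite Eb; apply: etrans Ec; congr (_ * _); apply: eq_bigr => i _; rewrite tb.
(* One coordinate is rescaled by the sign of the permutation, which makes the jacobian equal to
   1. *)
move=> s; pose c (i : 'I_d.+1) : k := if i == ord0 then (-1) ^+ s else 1.
have c0 i : c i != 0.
  by rewrite /c; case: (i == ord0); [rewrite signr_eq0 | exact: oner_neq0].
have [w Ew] := monomial_aut s c0; exists c, w; split=> //.
rewrite /Aut_star; apply: jac_conj; rewrite (jac_monomial Ew).
rewrite big_ord_recl /c eqxx big1 ?mulr1 => [|i _ //].
by rewrite -signr_addb addbb mpolyC1.
Qed.
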